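(* For a positive integer $k$ let $a_k$ be the number of limiting vacillating tableaux of length $2k$, and set $a_0=1$. Then for every positive integer $k$, $$a_k=\sum_{j=1}^{k}\left(\genfrac\{\}{0pt}{}{k}{j}\cdot\#\{\text{involutions in }\mathfrak{S}_j\}\right),$$ where $\genfrac\{\}{0pt}{}{k}{j}$ is the Stirling number of the second kind (the number of set partitions of $[k]$ into $j$ blocks) and $\mathfrak{S}_j$ is the symmetric group on $[j]$. It follows that the exponential generating function of the sequence $(a_k)_{k=0}^\infty$ is $$A(x)=\sum_{k\ge 0}a_k\frac{x^k}{k!}=\exp\left(\frac{e^{2x}-1}{2}\right).$$
   Context: Notation: $[n]=\{1,2,\dots,n\}$. An involution in $\mathfrak{S}_j$ is a permutation that is a product of disjoint $1$-cycles and $2$-cycles (i.e. $\sigma^2=1$, the identity included). Integer partitions are identified with their Young diagrams (English notation, rows left-justified, row $j$ having $\lambda_j$ boxes, rows numbered from the top). A partial tableau is a filling of the boxes of an integer partition (its shape) with distinct positive integers increasing along rows (left to right) and down columns. RSK row insertion $x\xrightarrow{RSK}T$, for a partial tableau $T$ and a positive integer $x$ not in $T$: let $R$ be the first row of $T$. While $x$ is less than some element of $R$: let $y$ be the smallest element of $R$ greater than $x$; replace $y$ in $R$ by $x$; set $x:=y$ and let $R$ be the next row. When $x$ is not less than any element of $R$, place $x$ at the end of $R$ (which is possibly empty). The result is a partial tableau. Jeu de taquin deletion $x\xleftarrow{jdt}T$, for a partial tableau $T$ and an entry $x$ of $T$: let $c$ be the box containing $x$, at position $(i,j)$ (row $i$,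 column $j$). While the position $(i,j)$ of $x$ is not a corner (a box that is both at the end of its row and at the end of its column), exchange $x$ with the smaller of the entries at positions $(i+1,j)$ and $(i,j+1)$ (if only one of these exists, exchange with that one), and update $(i,j)$ to be the new position of $x$. When $x$ is in a corner, delete that box. The result is a partial tableau. The vacillating tableau $P^k_m(\boldsymbol{i})$, for $\boldsymbol{i}=(i_1,\dots,i_k)\in[m]^k$: let $T^{(0)}$ be the tableau of one row of shape $(m)$ with entries $1,2,\dots,m$. For integers $j=0,1,\dots,k-1$ put $T^{(j+\frac12)}=\left(i_{j+1}\xleftarrow{jdt}T^{(j)}\right)$ and $T^{(j+1)}=\left(i_{j+1}\xrightarrow{RSK}T^{(j+\frac12)}\right)$. Let $\lambda^{(j)}$ be the shape of $T^{(j)}$ for every index $j\in\{0,\frac12,1,1\frac12,\dots,k\}$. Then $P^k_m(\boldsymbol{i})=(\lambda^{(0)},\lambda^{(\frac12)},\lambda^{(1)},\dots,\lambda^{(k-\frac12)},\lambda^{(k)})$. Simplified version: for an integer partition $\lambda=(\lambda_1,\lambda_2,\dots,\lambda_t)$, let $\lambda^*=(\lambda_2,\dots,\lambda_t)$ be obtained by removing the first part. For a sequence $P=(\lambda^{(j)}: j=0,\frac12,1,\dots,k)$ of partitions, $P^*=((\lambda^{(j)})^*: j=0,\frac12,1,\dots,k)$. Limiting vacillating tableau: for $\boldsymbol{i}\in[n]^k$, the sequence $(P^k_m(\boldsymbol{i}))^*$ is the same for all $m>n+2k$; this common value is denoted $P^*(\boldsymbol{i})$ and called the limiting vacillating tableau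 of $\boldsymbol{i}$. The limiting vacillating tableaux of length $2k$ are the distinct sequences $P^*(\boldsymbol{i})$ as $\boldsymbol{i}$ ranges over all sequences of $k$ positive integers. *)

(* Defs.v *)
From mathcomp Require Import all_boot all_order all_fingroup all_algebra.
From mathcomp Require Import finmap.
From mathcomp Require Import all_classical all_reals all_analysis.

Set Implicit Arguments.
Unset Strict Implicit.
Unset Printing Implicit Defensive.

Import GRing.Theory.

(* A partial tableau is the list of its nonempty rows, from top to bottom; an
   integer partition is the list of its (positive) parts.  Rows and columns are
   numbered from 0 in the code. *)
Definition tableau := seq (seq nat).
Definition intpart := seq nat.

Definition drop_empty (T : tableau) : tableau := [seq R <- T | R != [::]].

Definition shape_of (T : tableau) : intpart := [seq size R | R <- T].

(* Rows increase, so the first entry of R greater than x is the smallest one. *)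
Fixpoint rsk_insert (x : nat) (T : tableau) : tableau :=
  match T with
  | [::] => [:: [:: x]]
  | R :: T' =>
      if has (fun z => x < z) R then
        let p := find (fun z => x < z) R in
        set_nth 0 R p x :: rsk_insert (nth 0 R p) T'
      else rcons R x :: T'
  end.

(* The value 0 means that there is no box at (i, j): entries are positive. *)
Definition entry (T : tableau) (i j : nat) : nat := nth 0 (nth [::] T i) j.

Definition set_entry (T : tableau) (i j v : nat) : tableau :=
  set_nth [::] T i (set_nth 0 (nth [::] T i) j v).

Definition exchange (T : tableau) (i j i' j' : nat) : tableau :=
  set_entry (set_entry T i j (entry T i' j')) i' j' (entry T i j).

Definition remove_corner (T : tableau) (i j : nat) : tableau :=
  drop_empty (set_nth [::] T i (take j (nth [::] T i))).

(* (i, j) is the current position of the entry being deleted.  Each exchange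
   increases i + j, so that a fuel n equal to the number of boxes suffices and
   the case n = 0 is never reached from jdt_delete. *)
Fixpoint jdt_slide (n : nat) (T : tableau) (i j : nat) : tableau :=
  match n with
  | 0 => T
  | n'.+1 =>
      let below := entry T i.+1 j in
      let right := entry T i j.+1 in
      if (below == 0) && (right == 0) then remove_corner T i j
      else if (right == 0) || ((below != 0) && (below < right)) then
        jdt_slide n' (exchange T i j i.+1 j) i.+1 j
      else jdt_slide n' (exchange T i j i j.+1) i j.+1
  end.

Definition jdt_delete (x : nat) (T : tableau) : tableau :=
  let i := find (fun R => x \in R) T in
  let j := index x (nth [::] T i) in
  jdt_slide (sumn (shape_of T)) T i j.

Fixpoint vacillate (T : tableau) (s : seq nat) : seq intpart :=
  match s with
  | [::] => [:: shape_of T]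
  | x :: s' =>
      let T' := jdt_delete x T in
      shape_of T :: shape_of T' :: vacillate (rsk_insert x T') s'
  end.

(* P^k_m(s), with k = size s: the shapes of T^(0), T^(1/2), ..., T^(k). *)
Definition vacillating_tableau (m : nat) (s : seq nat) : seq intpart :=
  vacillate (drop_empty [:: iota 1 m]) s.

Definition star (P : seq intpart) : seq intpart := [seq behead l | l <- P].

Definition in_range (n : nat) (s : seq nat) : bool := all (fun x => 0 < x <= n) s.

(* P = P^*(s): for every n such that s is in [n]^k, P is the common value of
   the simplified vacillating tableaux over all m > n + 2k. *)
Definition is_limiting_tableau (k : nat) (s : k.-tuple nat) (P : seq intpart)
  : Prop :=
  forall n m : nat, in_range n s -> n + 2 * k < m ->
    star (vacillating_tableau m s) = P.

Definition limiting_tableaux (k : nat) : set (seq intpart) :=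
  [set P | exists s : k.-tuple nat,
     all (fun x => 0 < x) s /\ is_limiting_tableau s P]%classic.

(* fset_set sends an infinite set to the empty one; an equation between this
   cardinal and a positive number thus also says that the set is finite. *)
Definition num_limiting_tableaux (k : nat) : nat :=
  if k is 0 then 1 else #|` fset_set (limiting_tableaux k)|%fset.

Definition stirling2 (k j : nat) : nat :=
  #|[set P : {set {set 'I_k}} | finset.partition P [set: 'I_k] & #|P| == j]|.

Definition num_involutions (j : nat) : nat :=
  #|[set s : 'S_j | (s ^+ 2 == 1)%g]|.

Local Open Scope ring_scope.

(* A formal power series over the rationals is given by its coefficients. *)
Definition fps := nat -> rat.

Definition fps_one : fps := fun n => (n == 0%N)%:R.

Definition fps_mul (f g : fps) : fps :=
  fun n => \sum_(i < n.+1) f i * g (n - i)%N.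

Definition fps_pow (f : fps) (j : nat) : fps := iter j (fps_mul f) fps_one.

(* exp(f) = sum_j f^j / j!, for f with zero constant term: then f^j has no
   coefficient of degree n < j, whence the finite range of the sum. *)
Definition fps_exp (f : fps) : fps :=
  fun n => \sum_(j < n.+1) fps_pow f j n / (j`!)%:R.

Definition fps_2X : fps := fun n => 2 * (n == 1%N)%:R.

Definition egf (a : nat -> nat) : fps := fun k => (a k)%:R / (k`!)%:R.

(* Main.v *)
Require Import Defs.
From mathcomp Require Import all_boot all_order all_fingroup all_algebra.
From mathcomp Require Import finmap.
From mathcomp Require Import all_classical all_reals all_analysis.
From mathcomp Require Import zify ring.

(** Each step of a vacillating tableau deletes an entry and inserts it again. As long
    as m is large, the first row contains entries larger than the inserted one, so that
    one of them is bumped. Without its first row, the tableau thus loses at most one box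
    when the entry is deleted and gains exactly one box when it is inserted: a limiting
    vacillating tableau is a walk in Young's lattice from the empty partition that k
    times stays or goes down and then goes up (vacillate_walk). Every such walk occurs.
    Row insertion and jeu de taquin can be run backwards on the lower rows (rsk_reverse,
    jdt_reverse), and if all numbers involved are large, the beginning of the first row
    stays 1, 2, 3, ... and does not interfere with the lower rows (walk_realized). So
    a_k is the number of these walks.

    To count them, let U g (l) and D g (l) be the sums of g over the upper and the lower
    covers of l, and Y = 1 + D. The number of walks is ((Y U)^k 1)(empty). Young's
    lattice satisfies U D = D U + 1 (up_down_sum), hence U Y = Y U + 1, and U 1 = Y 1;
    moreover (Y g)(empty) = g(empty). Normal ordering of (Y U)^k, as for x d/dx, gives
    a_k as the sum of S(k, j) (U^j 1)(empty), and the numbers (U^j 1)(empty) satisfy the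
    recurrence t_(j+2) = t_(j+1) + (j + 1) t_j of the involutions. The Stirling numbers
    are identified through the expansion of x^k in falling factorials.

    For the generating function, M = Y U satisfies M Y^2 = Y^2 (M + 2), so that
    a_(n+1) is the sum over i of C(n, i) 2^i a_(n-i) (size_walks_rec). This is the equation
    A' = e^(2x) A, which determines the formal power series exp((e^(2x) - 1)/2). It is
    also the recurrence of the moments e^(-1/2) (sum over m of (2m)^k / (2^m m!)), which
    therefore equal a_k. Exchanging the sums over k and m then gives the value of the
    series at each real x: first for x >= 0, where all terms are nonnegative, and then
    for all x by comparing the tails at x and at |x|. *)

Set Implicit Arguments.
Unset Strict Implicit.
Unset Printing Implicit Defensive.

(** * Partitions and Young's lattice *)

Definition is_part (l : seq nat) := (0 \notin l) && sorted geq l.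

Definition addable (l : seq nat) r := (r == 0) || (nth 0 l r < nth 0 l r.-1).

Definition removable (l : seq nat) r := nth 0 l r.+1 < nth 0 l r.

(** A last part equal to 1 has to disappear, since partitions have no zero parts. *)
Definition decr_nth (l : seq nat) r :=
  if nth 0 l r == 1 then take r l else set_nth 0 l r (nth 0 l r).-1.

Lemma is_partP l :
  reflect (0 \notin l /\ forall i, nth 0 l i.+1 <= nth 0 l i) (is_part l).
Proof.
apply: (iffP andP) => -[l0 ls]; split=> //.
  move=> i; case: (ltnP i.+1 (size l)) => hi; last by rewrite nth_default.
  by move/(sortedP 0): ls => /(_ _ hi).
by apply/(sortedP 0) => i _; apply: ls.
Qed.

Lemma nth_part_gt0 l i : 0 \notin l -> (0 < nth 0 l i) = (i < size l).
Proof.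
move=> l0; case: (ltnP i (size l)) => hi; last by rewrite nth_default.
rewrite lt0n; apply: contra l0 => /eqP <-; exact: mem_nth.
Qed.

Lemma part_nonincr l i j : is_part l -> i <= j -> nth 0 l j <= nth 0 l i.
Proof.
case/is_partP=> _ dec; elim: j => [|j IH]; first by rewrite leqn0 => /eqP->.
rewrite leq_eqVlt => /orP[/eqP->//|]; rewrite ltnS => /IH; exact: leq_trans.
Qed.

(** Positive parts determine the length, so the parts read with default value 0
    determine the partition. *)
Lemma part_ext l l' : 0 \notin l -> 0 \notin l' ->
  (forall i, nth 0 l i = nth 0 l' i) -> l = l'.
Proof.
move=> l0 l0' e; apply: (@eq_from_nth _ 0) => [|i _]; last exact: e.
have h i : (i < size l) = (i < size l') by rewrite -!nth_part_gt0 // e.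
by apply/eqP; rewrite eqn_leq leqNgt h ltnn leqNgt -h ltnn.
Qed.

Lemma part_incr l r : is_part l -> is_part (incr_nth l r) = addable l r.
Proof.
move=> pl; case/is_partP: (pl) => l0 dec.
apply/is_partP/idP => [[_ dec']|ad].
  case: r dec' => [//|r] /(_ r); rewrite !nth_incr_nth /addable /=; lia.
have rs : r <= size l.
  case: r ad => [//|r]; rewrite /addable /= => h.
  rewrite -nth_part_gt0 //; lia.
split=> [|i].
  apply/negP=> /(nthP 0) [i]; rewrite size_incr_nth => hi.
  rewrite nth_incr_nth; case: eqVneq => // ri; move: hi; rewrite add0n.
  have [_ hi|sr hi] := ltnP r (size l) => /eqP.
    by rewrite -leqn0 leqNgt nth_part_gt0 // hi.
  by rewrite -leqn0 leqNgt nth_part_gt0 // (_ : i < size l) //; lia.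
rewrite !nth_incr_nth; have := dec i; move: ad; rewrite /addable.
case: (eqVneq r i) => [->|_]; first lia.
by case: (eqVneq r i.+1) => [->|_] /=; lia.
Qed.

Lemma nth_decr l s i : is_part l -> removable l s ->
  nth 0 (decr_nth l s) i = nth 0 l i - (s == i).
Proof.
move=> pl; rewrite /removable /decr_nth => rs.
case: eqP => [l1|_]; last first.
  rewrite nth_set_nth /= eq_sym; case: eqP => [->|_]; rewrite ?subn0 //; lia.
case: (ltngtP i s) => [lis|lsi|->]; last by rewrite l1 nth_default // size_take geq_minl.
  by rewrite nth_take // subn0.
rewrite nth_default; last by rewrite size_take (leq_trans (geq_minl _ _)) // ltnW.
have := part_nonincr pl lsi; lia.
Qed.

Lemma part_decr l s : is_part l -> removable l s -> is_part (decr_nth l s).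
Proof.
move=> pl rs; case/is_partP: (pl) => l0 dec; apply/is_partP; split; last first.
  by move=> i; rewrite !nth_decr //; have := dec i; move: rs; rewrite /removable;
     case: (eqVneq s i) => [->|_]; lia.
rewrite /decr_nth; case: eqP => l1.
  by apply: contra l0; apply: mem_take.
apply/negP=> /(nthP 0) [i]; rewrite size_set_nth nth_set_nth /=.
have := nth_part_gt0 s l0; have := nth_part_gt0 i l0; move: rs.
by rewrite /removable; case: eqP => [->|_] /=; lia.
Qed.

Lemma incr_decr l s : is_part l -> removable l s ->
  incr_nth (decr_nth l s) s = l.
Proof.
move=> pl rs; have pd := part_decr pl rs.
case/is_partP: (pl) => l0 _; apply: part_ext => //.
  have : is_part (incr_nth (decr_nth l s) s).
    rewrite part_incr // /addable !nth_decr // eqxx; move: rs; rewrite /removable.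
    case: s {pd} => [//|s] /=; case/is_partP: pl => _ /(_ s); lia.
  by case/is_partP.
move=> i; rewrite nth_incr_nth nth_decr //; move: rs; rewrite /removable.
by case: eqP => [->|_]; lia.
Qed.

Lemma removable_incr l r : is_part l -> removable (incr_nth l r) r.
Proof.
case/is_partP=> _ dec; rewrite /removable !nth_incr_nth eqxx; have := dec r.
by rewrite (_ : (r == r.+1) = false); lia.
Qed.

Lemma decr_incr l r : is_part l -> is_part (incr_nth l r) ->
  decr_nth (incr_nth l r) r = l.
Proof.
move=> pl pr; have rr := removable_incr r pl.
apply: part_ext; [|by case/is_partP: pl|].
  by case/is_partP: (part_decr pr rr).
by move=> i; rewrite nth_decr // nth_incr_nth; lia.
Qed.

Lemma addable_decr l s : is_part l -> removable l s -> addable (decr_nth l s) s.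
Proof. by move=> pl rs; rewrite -part_incr ?incr_decr ?part_decr. Qed.

Lemma addable_le l r : is_part l -> addable l r -> r <= size l.
Proof.
case/is_partP=> l0 _; case: r => [//|r]; rewrite /addable /= => h.
by rewrite -nth_part_gt0 //; lia.
Qed.

Lemma removable_lt l r : is_part l -> removable l r -> r < size l.
Proof. by case/is_partP=> l0 _; rewrite /removable -nth_part_gt0 //; lia. Qed.

Lemma sumn_incr l r : sumn (incr_nth l r) = (sumn l).+1.
Proof.
elim: l r => [|a l IH] [|r] //=; last by rewrite IH addnS.
by elim: r => //= r; rewrite !addn0.
Qed.

Definition up l := [seq incr_nth l r | r <- iota 0 (size l).+1 & addable l r].
Definition down l := [seq decr_nth l r | r <- iota 0 (size l) & removable l r].

Lemma mem_up l r : is_part l -> is_part (incr_nth l r) -> incr_nth l r \in up l.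
Proof.
move=> pl pr; apply: map_f; rewrite mem_filter mem_iota.
rewrite part_incr // in pr; rewrite pr /= add0n ltnS; exact: addable_le.
Qed.

Lemma mem_down l r : is_part l -> is_part (incr_nth l r) ->
  l \in down (incr_nth l r).
Proof.
move=> pl pr; apply/mapP; exists r; last by rewrite decr_incr.
by rewrite mem_filter mem_iota /= removable_incr // removable_lt ?removable_incr.
Qed.

Lemma upP l l' : is_part l -> l' \in up l ->
  is_part l' /\ exists r, l' = incr_nth l r.
Proof.
move=> pl /mapP[r]; rewrite mem_filter => /andP[ar _] ->.
by split; [rewrite part_incr | exists r].
Qed.

Lemma downP l l' : is_part l -> l' \in down l ->
  is_part l' /\ exists r, l = incr_nth l' r.
Proof.
move=> pl /mapP[r]; rewrite mem_filter => /andP[ar _] ->.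
by split; [exact: part_decr | exists r; rewrite incr_decr].
Qed.

Lemma up_uniq l : uniq (up l).
Proof.
rewrite map_inj_uniq ?filter_uniq ?iota_uniq //; exact: incr_nth_inj.
Qed.

Lemma down_uniq l : is_part l -> uniq (down l).
Proof.
move=> pl; rewrite map_inj_in_uniq ?filter_uniq ?iota_uniq // => r r'.
rewrite !mem_filter => /andP[hr _] /andP[hr' _] e.
have e1 : nth 0 (decr_nth l r) r = nth 0 (decr_nth l r') r by rewrite e.
move: e1; rewrite !nth_decr // eqxx; move: hr; rewrite /removable.
by case: (eqVneq r' r) => //; lia.
Qed.

Lemma down_neq l : is_part l -> l \notin down l.
Proof.
move=> pl; apply/negP=> /downP [] // _ [r] e.
by have := sumn_incr l r; rewrite -e; lia.
Qed.

Definition up_sum (g : seq nat -> nat) l := \sum_(l' <- up l) g l'.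
Definition down_sum (g : seq nat -> nat) l := \sum_(l' <- down l) g l'.
Definition stay_or_down (g : seq nat -> nat) l := g l + down_sum g l.

(** The commutation relations below hold on partitions only, so operators on
    functions are compared there. *)
Definition eqpart (f g : seq nat -> nat) := forall l, is_part l -> f l = g l.

(** Summing over all row indices below any large enough bound gives the sums over
    different partitions a common range, which makes them exchangeable. *)
Lemma up_sumE g l N : is_part l -> size l < N ->
  up_sum g l = \sum_(0 <= r < N | addable l r) g (incr_nth l r).
Proof.
move=> pl hN; rewrite /up_sum /up big_map big_filter /=.
rewrite (@big_cat_nat _ _ _ (size l).+1) //= [X in _ = _ + X]big_nat_cond.
rewrite [X in _ = _ + X]big_pred0 ?addn0 ?/index_iota ?subn0 // => r.
by apply/negP=> /andP[/andP[h _] /(addable_le pl)]; lia.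
Qed.

Lemma down_sumE g l N : is_part l -> size l <= N ->
  down_sum g l = \sum_(0 <= r < N | removable l r) g (decr_nth l r).
Proof.
move=> pl hN; rewrite /down_sum /down big_map big_filter /=.
rewrite (@big_cat_nat _ _ _ (size l)) //= [X in _ = _ + X]big_nat_cond.
rewrite [X in _ = _ + X]big_pred0 ?addn0 ?/index_iota ?subn0 // => r.
by apply/negP=> /andP[/andP[h _] /(removable_lt pl)]; lia.
Qed.

(** A row r + 1 is addable exactly when row r is removable, and row 0 is always
    addable: a partition has one more upper cover than lower covers. *)
Lemma up_sum1 l : is_part l ->
  up_sum (fun=> 1) l = stay_or_down (fun=> 1) l.
Proof.
move=> pl; rewrite /stay_or_down (@up_sumE _ _ (size l).+1) //.
rewrite (@down_sumE _ _ (size l)) // !sum1_count.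
by rewrite /index_iota !subn0 /= -add1n iotaDl count_map.
Qed.

(** In different rows both conditions say that l, with a box added in row r and
    one removed in row s, is a partition; only r = s + 1 needs to be looked at. *)
Lemma swap_moves l r s : is_part l -> r != s ->
  (addable l r && removable (incr_nth l r) s) =
  (removable l s && addable (decr_nth l s) r).
Proof.
move=> pl rs; case: (boolP (removable l s)) => /= [hs|].
  rewrite {2}/addable !nth_decr // /addable /removable !nth_incr_nth.
  move: hs; rewrite /removable; case/is_partP: pl => _ /(_ r.-1).
  case: r rs => [|r] /= rs; first by case: eqVneq rs => //; lia.
  case: (eqVneq r s) => [<-|rs']; first by rewrite eqxx; lia.
  by rewrite eqSS (negPf rs') (eq_sym s) (negPf rs) !add0n !subn0 => _ ->; rewrite andbT.
rewrite /removable !nth_incr_nth /addable => h.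
by apply/negP=> /andP[]; lia.
Qed.

Lemma swap_shapes l r s : is_part l -> r != s ->
  addable l r -> removable (incr_nth l r) s ->
  decr_nth (incr_nth l r) s = incr_nth (decr_nth l s) r.
Proof.
move=> pl rs ar rls.
have /andP[rs' ar'] : removable l s && addable (decr_nth l s) r.
  by rewrite -swap_moves ?ar.
have pr : is_part (incr_nth l r) by rewrite part_incr.
have pd := part_decr pl rs'.
apply: part_ext.
- by case/is_partP: (part_decr pr rls).
- by have : is_part (incr_nth (decr_nth l s) r) by [rewrite part_incr]; case/is_partP.
move=> i; rewrite nth_decr // !nth_incr_nth nth_decr //.
by case: (eqVneq s i) => [<-|_]; lia.
Qed.

(** Young's lattice is a differential poset. The moves in two different rows can
    be made in either order, and the moves up and down in the same row lead back
    to l, once for each upper cover in one order and once for each lower cover in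
    the other order. *)
Lemma up_down_sum g l : is_part l ->
  up_sum (down_sum g) l = down_sum (up_sum g) l + g l.
Proof.
move=> pl; pose N := (size l).+2.
(* The contribution of two moves in different rows, common to both sides. *)
pose X r s := if (r != s) && (addable l r && removable (incr_nth l r) s)
              then g (decr_nth (incr_nth l r) s) else 0.
have bigX r (P : pred nat) (F : nat -> nat) : r < N -> P r ->
    \sum_(0 <= s < N | P s) F s =
    F r + \sum_(0 <= s < N) if (r != s) && P s then F s else 0.
  move=> rN Pr; rewrite big_mkcond (bigD1_seq r) ?iota_uniq ?mem_index_iota //=.
  rewrite Pr; congr (_ + _); rewrite big_mkcond; apply: eq_bigr => s _.
  by rewrite eq_sym; case: eqP.
transitivity (up_sum (fun=> 1) l * g l + \sum_(0 <= r < N) \sum_(0 <= s < N) X r s).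
  rewrite !(@up_sumE _ _ N) //.
  rewrite big_distrl /= [LHS]big_mkcond [X in _ = X + _]big_mkcond -big_split /=.
  rewrite big_nat_cond [RHS]big_nat_cond; apply: eq_bigr => r /andP[/andP[_ rN] _].
  case: ifP => ar; last by rewrite big1 // => s _; rewrite /X ar andbF.
  have pr : is_part (incr_nth l r) by rewrite part_incr.
  rewrite (@down_sumE _ _ N) //; last first.
    by rewrite size_incr_nth; have := addable_le pl ar; rewrite /N; case: ifP; lia.
  rewrite (bigX r) // ?removable_incr // decr_incr // mul1n; congr (_ + _).
  by apply: eq_bigr => s _; rewrite /X ar.
rewrite up_sum1 // /stay_or_down mulnDl mul1n -addnA [RHS]addnC; congr (_ + _).
have lN : size l <= N by rewrite /N; lia.
(* The moves in different rows are now sorted by the removed box first. *)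
rewrite exchange_big /= !(@down_sumE _ _ N) //.
rewrite big_distrl /= [X in X + _ = _]big_mkcond [RHS]big_mkcond -big_split /=.
rewrite big_nat_cond [RHS]big_nat_cond; apply: eq_bigr => s /andP[/andP[_ sN] _].
case: ifP => rs; last first.
  rewrite big1 // => r _; rewrite /X; case: (eqVneq r s) => //= ne.
  by rewrite swap_moves // rs.
have pd := part_decr pl rs.
rewrite (@up_sumE _ _ N) //; last first.
  rewrite /decr_nth; case: ifP => _; rewrite ?size_take ?size_set_nth /N.
    by case: ifP; lia.
  by have := removable_lt pl rs; rewrite /maxn; case: ifP; lia.
rewrite (bigX s (addable (decr_nth l s))) // ?addable_decr // incr_decr // mul1n; congr (_ + _).
apply: eq_bigr => r _; rewrite /X eq_sym; case: (eqVneq s r) => //= ne.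
rewrite swap_moves 1?eq_sym // rs /=; case: ifP => // ar.
rewrite swap_shapes 1?eq_sym //.
  by have := @swap_moves l r s pl; rewrite eq_sym ne rs ar => /(_ isT) /andP[].
by have := @swap_moves l r s pl; rewrite eq_sym ne rs ar => /(_ isT) /andP[].
Qed.

(** * Walks in Young's lattice and their number *)

(** A walk stays or goes down, then goes up, k times; its shapes are listed in the
    order in which a vacillating tableau lists them. *)
Fixpoint walks k l : seq (seq (seq nat)) :=
  if k is k'.+1 then
    [seq l :: l1 :: w | l1 <- l :: down l,
                        w <- [seq w | l2 <- up l1, w <- walks k' l2]]
  else [:: [:: l]].

Lemma walksS k l : walks k.+1 l =
  [seq l :: l1 :: w | l1 <- l :: down l,
                      w <- [seq w | l2 <- up l1, w <- walks k l2]].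
Proof. by []. Qed.

(** The transfer operator: one step of a walk seen from its starting shape. *)
Definition walk_step g := stay_or_down (up_sum g).

Lemma size_walks k l : size (walks k l) = iter k walk_step (fun=> 1) l.
Proof.
elim: k l => [//|k IH] l; rewrite [LHS]size_allpairs_dep sumnE big_map.
have h l1 : size [seq w | l2 <- up l1, w <- walks k l2] =
            up_sum (iter k walk_step (fun=> 1)) l1.
  by rewrite size_allpairs_dep sumnE big_map; apply: eq_bigr => l2 _.
by rewrite big_cons h; congr (_ + _); apply: eq_bigr.
Qed.

Lemma walks_head k l w : w \in walks k l -> head [::] w = l.
Proof.
case: k => [|k]; first by rewrite inE => /eqP->.
by case/allpairsPdep=> l1 [w' [_ _ ->]].
Qed.

(** Each walk begins with its starting shape, so the walks from different shapes
    are different lists. *)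
Lemma walks_uniq k l : is_part l -> uniq (walks k l).
Proof.
elim: k l => [//|k IH] l pl; rewrite walksS.
have pl1 l1 : l1 \in l :: down l -> is_part l1.
  by rewrite inE => /predU1P[->//|/(downP pl)[]].
apply: allpairs_uniq_dep => [|l1 hl1|].
- by rewrite /= down_neq // down_uniq.
- apply: allpairs_uniq_dep => [|l2 hl2|]; first exact: up_uniq.
    by apply: IH; case: (upP (pl1 _ hl1) hl2).
  move=> _ _ /allpairsPdep[l2 [w [h2 hw ->]]] /allpairsPdep[l2' [w' [h2' hw' ->]]] /= e.
  by move: hw'; rewrite -e => /walks_head; rewrite (walks_head hw) => <-.
- move=> _ _ /allpairsPdep[l1 [w [h1 hw ->]]] /allpairsPdep[l1' [w' [h1' hw' ->]]] /=.
  by case=> -> ->.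
Qed.

Lemma up_sum_eq f g : eqpart f g -> eqpart (up_sum f) (up_sum g).
Proof.
by move=> fg l pl; apply: eq_big_seq => l' /(upP pl)[pl' _]; apply: fg.
Qed.

Lemma stay_or_down_eq f g : eqpart f g -> eqpart (stay_or_down f) (stay_or_down g).
Proof.
move=> fg l pl; congr (_ + _); first exact: fg.
by apply: eq_big_seq => l' /(downP pl)[pl' _]; apply: fg.
Qed.

Lemma iter_eqpart (F : (seq nat -> nat) -> seq nat -> nat) :
  (forall f g, eqpart f g -> eqpart (F f) (F g)) ->
  forall n f g, eqpart f g -> eqpart (iter n F f) (iter n F g).
Proof. by move=> hF; elim=> [//|n IH] f g /IH; apply: hF. Qed.

Lemma up_sumD f g l : up_sum (fun l => f l + g l) l = up_sum f l + up_sum g l.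
Proof. exact: big_split. Qed.

Lemma up_sumM c f l : up_sum (fun l => c * f l) l = c * up_sum f l.
Proof. by rewrite /up_sum big_distrr. Qed.

Lemma stay_or_downD f g l :
  stay_or_down (fun l => f l + g l) l = stay_or_down f l + stay_or_down g l.
Proof. by rewrite /stay_or_down /down_sum big_split /= addnACA. Qed.

Lemma stay_or_downM c f l : stay_or_down (fun l => c * f l) l = c * stay_or_down f l.
Proof. by rewrite /stay_or_down /down_sum mulnDr big_distrr. Qed.

(** Y = 1 + D satisfies U Y = Y U + 1, because D does so; unlike D, the operator Y
    is invisible at the empty partition. *)
Lemma up_sum_stay g :
  eqpart (up_sum (stay_or_down g)) (fun l => stay_or_down (up_sum g) l + g l).
Proof. by move=> l pl; rewrite up_sumD up_down_sum // addnA. Qed.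

(** U^j Y = Y U^j + j U^(j-1), by commuting Y to the left. *)
Lemma iter_up_sum_stay j g :
  eqpart (iter j up_sum (stay_or_down g))
         (fun l => stay_or_down (iter j up_sum g) l + j * iter j.-1 up_sum g l).
Proof.
elim: j => [|j IH] l pl /=; first by rewrite mul0n addn0.
rewrite (up_sum_eq IH pl) up_sumD up_sumM up_sum_stay // -addnA; congr (_ + _).
case: j {IH} => [|j] /=; first by rewrite mul0n mul1n addn0.
by rewrite -mulSn.
Qed.

(** Nothing can be removed from the empty partition. *)
Lemma stay_or_down0 g : stay_or_down g [::] = g [::].
Proof. by rewrite /stay_or_down /down_sum big_nil addn0. Qed.

Fixpoint stirling_rec k j :=
  match k, j with
  | 0, 0 => 1
  | k'.+1, j'.+1 => stirling_rec k' j' + j * stirling_rec k' j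
  | _, _ => 0
  end.

Lemma stirling_rec_small k j : k < j -> stirling_rec k j = 0.
Proof.
elim: k j => [|k IH] [|j] //= kj.
by rewrite !IH ?muln0 // ltnW.
Qed.

(** Normal ordering: (Y U)^k is the sum of S(k, j) Y^j U^j, and Y acts as the
    identity at the empty partition. Here the recurrence of the Stirling numbers
    comes from U^j Y U = Y U^(j+1) + j U^j. *)
Lemma walk_step_iter0 k g :
  iter k walk_step g [::] = \sum_(j < k.+1) stirling_rec k j * iter j up_sum g [::].
Proof.
elim: k g => [|k IH] g; first by rewrite big_ord1 mul1n.
rewrite iterSr IH.
have step j : iter j up_sum (walk_step g) [::] =
    iter j.+1 up_sum g [::] + j * iter j up_sum g [::].
  rewrite iter_up_sum_stay // stay_or_down0 -iterSr; congr (_ + _).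
  by case: j => // j; rewrite -iterSr.
under eq_bigr do rewrite step mulnDr.
rewrite big_split /= [RHS]big_ord_recl mul0n add0n.
under [RHS]eq_bigr do rewrite /= mulnDl.
rewrite [RHS]big_split /=; congr (_ + _).
rewrite [RHS]big_ord_recr /= stirling_rec_small // muln0 mul0n addn0 big_ord_recl.
rewrite mul0n muln0 add0n; apply: eq_bigr => i _ /=.
by rewrite mulnCA mulnA.
Qed.

Fixpoint invol_rec n :=
  match n with
  | 0 => 1
  | 1 => 1
  | (n'.+1 as m).+1 => invol_rec m + m * invol_rec n'
  end.

(** Since U 1 = Y 1, the relation U^j Y = Y U^j + j U^(j-1) yields the recurrence
    of the involution numbers. *)
Lemma invol_rec_up j : iter j up_sum (fun=> 1) [::] = invol_rec j.
Proof.
suff h : iter j up_sum (fun=> 1) [::] = invol_rec j /\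
         iter j.+1 up_sum (fun=> 1) [::] = invol_rec j.+1 by case: h.
elim: j => [|j [IH1 IH2]]; first by rewrite /= up_sum1 // stay_or_down0.
split=> //; rewrite iterSr (iter_eqpart up_sum_eq _ up_sum1) //.
by rewrite iter_up_sum_stay // stay_or_down0 IH1 IH2.
Qed.

Lemma size_walks_stirling k :
  size (walks k [::]) = \sum_(j < k.+1) stirling_rec k j * invol_rec j.
Proof.
rewrite size_walks walk_step_iter0.
by apply: eq_bigr => j _; rewrite invol_rec_up.
Qed.

Lemma walk_step_eq f g : eqpart f g -> eqpart (walk_step f) (walk_step g).
Proof. by move=> fg; apply/stay_or_down_eq/up_sum_eq. Qed.

Lemma walk_step_linear c f g l :
  walk_step (fun l => f l + c * g l) l = walk_step f l + c * walk_step g l.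
Proof.
rewrite /walk_step -stay_or_downM -stay_or_downD /stay_or_down /down_sum.
congr (_ + _); first by rewrite up_sumD up_sumM.
by apply: eq_bigr => l' _; rewrite up_sumD up_sumM.
Qed.

(** With M = Y U this is M Y^2 = Y^2 (M + 2). *)
Lemma walk_step_stay2 g :
  eqpart (walk_step (stay_or_down (stay_or_down g)))
         (stay_or_down (stay_or_down (fun l => walk_step g l + 2 * g l))).
Proof.
move=> l pl.
have e : eqpart (up_sum (stay_or_down (stay_or_down g)))
   (stay_or_down (fun l => walk_step g l + 2 * g l)).
  move=> {}l {}pl; rewrite up_sum_stay // stay_or_downD stay_or_downM.
  rewrite (stay_or_down_eq (@up_sum_stay g) pl) stay_or_downD.
  by rewrite mul2n -addnn addnA.
exact: stay_or_down_eq e _ pl.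
Qed.

Lemma iter_walk_step_linear n c f g :
  eqpart (iter n walk_step (fun l => f l + c * g l))
         (fun l => iter n walk_step f l + c * iter n walk_step g l).
Proof.
elim: n => [//|n IH] l pl.
by rewrite iterS (walk_step_eq IH pl) walk_step_linear.
Qed.

(** The binomial expansion of M^n Y^2 = Y^2 (M + 2)^n. *)
Lemma iter_walk_step_stay2 n g :
  eqpart (iter n walk_step (stay_or_down (stay_or_down g)))
    (stay_or_down (stay_or_down
      (fun l => \sum_(i < n.+1) 'C(n, i) * 2 ^ i * iter (n - i) walk_step g l))).
Proof.
elim: n g => [|n IH] g l pl.
  by apply: stay_or_down_eq pl; apply: stay_or_down_eq => l' _; rewrite big_ord1 mul1n.
rewrite iterSr (iter_eqpart walk_step_eq n (@walk_step_stay2 g) pl) IH //.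
apply: stay_or_down_eq pl; apply: stay_or_down_eq => {}l pl.
under eq_bigr => i _ do rewrite iter_walk_step_linear // -iterSr mulnDr.
rewrite big_split /= [RHS]big_ord_recl /= .
under [X in _ = _ + X]eq_bigr => i _ do
  rewrite /bump /= add1n subSS binS !mulnDl.
rewrite [X in _ = _ + X]big_split /= addnA; congr (_ + _).
  rewrite big_ord_recl subn0 !bin0; congr (_ + _).
  rewrite [RHS]big_ord_recr /= bin_small // !mul0n addn0.
  by apply: eq_bigr => i _; rewrite /bump /= add1n -iterS -subSn.
by apply: eq_bigr => i _; rewrite expnS; lia.
Qed.

(** This is the differential equation A' = e^(2x) A for the exponential generating
    function. It follows from M 1 = Y^2 1 and M^n Y^2 = Y^2 (M + 2)^n. *)
Lemma size_walks_rec n :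
  size (walks n.+1 [::]) =
  \sum_(i < n.+1) 'C(n, i) * 2 ^ i * size (walks (n - i) [::]).
Proof.
rewrite size_walks iterSr.
have e : eqpart (walk_step (fun=> 1)) (stay_or_down (stay_or_down (fun=> 1))).
  by move=> l pl; apply: stay_or_down_eq up_sum1 _ pl.
rewrite (iter_eqpart walk_step_eq n e) // iter_walk_step_stay2 // !stay_or_down0.
by apply: eq_bigr => i _; rewrite size_walks.
Qed.

(** * Involutions and set partitions *)

Section Involutions.
Variable T : finType.
Implicit Types (A : {set T}) (s : {perm T}).
Import GroupScope.

(** Involutions supported in a subset, so that the induction that removes points
    stays within one symmetric group. *)
Definition invols A := [set s : {perm T} | perm_on A s & s * s == 1].

Lemma perm_on_fix A s x : perm_on A s -> s x = x -> perm_on (A :\ x) s.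
Proof.
move=> /fintype.subsetP sA sx; apply/fintype.subsetP=> z hz; rewrite !inE sA // andbT.
by apply: contraTneq hz => ->; rewrite !inE sx eqxx.
Qed.

Lemma perm_onW (A B : {set T}) s : A \subset B -> perm_on A s -> perm_on B s.
Proof. by move=> AB sA; apply: fintype.subset_trans AB. Qed.

(** Multiplication by the transposition of x and y removes the 2-cycle (x y). *)
Lemma card_invols_move A x y : x \in A -> y \in A :\ x ->
  #|[set s in invols A | s x == y]| = #|invols (A :\ x :\ y)|.
Proof.
move=> xA; rewrite !inE => /andP[yx yA].
rewrite -[RHS](card_imset _ (mulgI (tperm x y))); apply: eq_card => s.
have txyA : perm_on A (tperm x y).
  by apply: perm_onW (tperm_on x y); apply/fintype.subsetP=> z; rewrite !inE => /orP[]/eqP->.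
have sub : A :\ x :\ y \subset A by rewrite !finset.subDset finset.setUA finset.subsetUr.
apply/idP/imsetP => [|[u]].
  rewrite !inE => /andP[/andP[sA /eqP s2] /eqP sx].
  have sy : s y = x by rewrite -sx -permM s2 perm1.
  have com : commute (tperm x y) s.
    by rewrite /commute conjgC tpermJ sx sy tpermC.
  exists (tperm x y * s); last by rewrite mulgA tperm2 mul1g.
  rewrite inE; apply/andP; split.
    apply: perm_on_fix; last by rewrite permM tpermR.
    by apply: perm_on_fix; [apply: perm_onM | rewrite permM tpermL].
  by rewrite {1}com mulgA -(mulgA s) tperm2 mulg1 s2.
case/setIdP=> uA /eqP u2 ->.
have com : commute (tperm x y) u.
  apply: (perm_onC (tperm_on x y) uA).
  by rewrite -finset.setI_eq0; apply/eqP/finset.setP=> z; rewrite !inE; case: eqP => //= _; case: eqP.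
(* y is not moved by u, so the product sends x to y. *)
have uy : u y = y by apply: (out_perm uA); rewrite !inE eqxx.
rewrite !inE permM tpermL uy eqxx andbT (perm_onM txyA (perm_onW sub uA)) /=.
by rewrite {2}com mulgA -(mulgA _ u u) u2 mulg1 tperm2.
Qed.

(** Either x is fixed, or x is exchanged with one of the other points. *)
Lemma card_invols n A : #|A| = n -> #|invols A| = invol_rec n.
Proof.
have invols0 (B : {set T}) : #|B| <= 1 -> invols B = [set 1].
  move=> B1; apply/finset.setP=> s; rewrite !inE; apply/andP/eqP => [[sB _]|->].
    exact: perm_on_id sB B1.
  by rewrite perm_on1 mulg1 eqxx.
elim/ltn_ind: n A => -[|[|n]] IH A cA; try by rewrite invols0 ?cA ?cards1.
have /card_gt0P[x xA] : 0 < #|A| by rewrite cA.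
have cAx : #|A :\ x| = n.+1 by apply/eqP; move: cA; rewrite (cardsD1 x) xA add1n => -[->].
rewrite -(cardsID [set s : {perm T} | s x == x]) [invol_rec _]/= -/(invol_rec n.+1).
congr (_ + _).
  rewrite -(IH n.+1 (ltnSn _) _ cAx); apply: eq_card => s; rewrite !inE.
  apply/idP/idP => [/andP[/andP[sA ->] /eqP sx]|/andP[sA ->]].
    by rewrite (perm_on_fix sA sx).
  rewrite (perm_onW _ sA) ?finset.subsetDl //=; apply/eqP/(out_perm sA).
  by rewrite !inE eqxx.
transitivity (\sum_(y in A :\ x) #|[set s in invols A | s x == y]|).
  rewrite -sum1_card (partition_big (fun s : {perm T} => s x) (mem (A :\ x))) /=.
    apply: eq_bigr => y yAx; rewrite -sum1_card; apply: eq_bigl => s.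
    rewrite !inE; case: (eqVneq (s x) y) => [->|]; rewrite ?andbF ?andbT //.
    by move: yAx; rewrite !inE => /andP[->].
  by move=> s; rewrite !inE => /andP[-> /andP[/perm_closed->]].
rewrite -cAx -sum_nat_const; apply: eq_bigr => y yAx.
rewrite card_invols_move //; apply: IH => //.
by apply/eqP; move: cAx; rewrite (cardsD1 y) yAx add1n => -[->].
Qed.
End Involutions.

Lemma num_involutionsE j : num_involutions j = invol_rec j.
Proof.
rewrite -(@card_invols 'I_j j finset.setT) ?cardsT ?card_ord //.
apply: eq_card => s; rewrite !inE expgS expg1.
by rewrite (_ : perm_on _ _) //; apply/fintype.subsetP=> x; rewrite inE.
Qed.

Lemma powers_ffact k x : x ^ k = \sum_(j < k.+1) stirling_rec k j * x ^_ j.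
Proof.
elim: k => [|k IH]; first by rewrite big_ord1.
rewrite expnS IH big_distrr [RHS]big_ord_recl mul0n add0n /=.
under [RHS]eq_bigr do rewrite mulnDl ffactnSr.
rewrite big_split /= [X in _ = _ + X]big_ord_recr /= stirling_rec_small // muln0 mul0n addn0.
under eq_bigr => j _.
  rewrite (_ : x * _ = stirling_rec k j * (x ^_ j * (x - j)) + j * stirling_rec k j * x ^_ j); last first.
    have [jx|xj] := leqP j x.
      by rewrite -{1}(subnK jx) mulnDl; congr (_ + _); lia.
    by rewrite ffact_small // !muln0.
  over.
rewrite big_split /=; congr (_ + _).
by rewrite big_ord_recl mul0n /= add0n; apply: eq_bigr => i _; rewrite /bump /= add1n ffactnSr.
Qed.

Section KernelCount.
Variables k x : nat.
Implicit Type P : {set {set 'I_k}}.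

Definition kernel (f : {ffun 'I_k -> 'I_x}) := preim_partition f [set: 'I_k].

(** A function whose fibres are the blocks of P is an injection from P. *)
Lemma card_kernel P : finset.partition P [set: 'I_k] ->
  #|[set f | kernel f == P]| = x ^_ #|P|.
Proof.
move=> pP; have /and3P[/eqP cP tP nP] := pP.
pose D := {B : {set 'I_k} | B \in P}.
have blockP i : finset.pblock P i \in P by rewrite pblock_mem // cP inE.
pose b i : D := Sub (finset.pblock P i) (blockP i).
pose F (g : {ffun D -> 'I_x}) : {ffun 'I_k -> 'I_x} := [ffun i => g (b i)].
have bP (B : D) : exists i, b i == B.
  have /set0Pn[i iB] : val B != finset.set0.
    by apply: contraNneq nP => <-; apply: valP.
  by exists i; apply/eqP/val_inj; apply: def_pblock => //; apply: valP.
have Finj : injective F.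
  move=> g g' /ffunP e; apply/ffunP=> B; case: (bP B) => i /eqP<-.
  by have := e i; rewrite !ffunE.
have -> : x ^_ #|P| = #|'I_x| ^_ #|{: D}| by rewrite card_ord card_sig.
rewrite -card_inj_ffuns.
rewrite -[RHS](card_imset _ Finj); apply: eq_card => f.
have kerE (h : {ffun 'I_k -> 'I_x}) i j :
    (j \in finset.pblock (kernel h) i) = (h i == h j).
  rewrite pblock_equivalence_partition ?inE //.
  by split=> // /eqP->.
rewrite inE; apply/eqP/imsetP => [fP|[g]].
  exists [ffun B => f (xchoose (bP B))]; last first.
    apply/ffunP=> i; rewrite !ffunE; apply/eqP; rewrite -kerE fP.
    have /eqP/(congr1 val)/= e := xchooseP (bP (b i)).
    by rewrite -eq_pblock ?cP ?inE // e.
  rewrite inE; apply/injectiveP=> B B'; rewrite !ffunE => /eqP.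
  rewrite -kerE fP -eq_pblock ?cP ?inE // => /eqP e.
  by rewrite -(eqP (xchooseP (bP B))) -(eqP (xchooseP (bP B'))); apply: val_inj.
rewrite inE => /injectiveP gI ->; rewrite -[RHS](equivalence_partition_pblock pP).
rewrite /kernel /preim_partition /equivalence_partition; apply: eq_imset => i.
apply/finset.setP=> j; rewrite !inE !ffunE (inj_eq gI) -eq_pblock ?cP ?inE //.
Qed.
End KernelCount.

Lemma card_partition_ord k (P : {set {set 'I_k}}) :
  finset.partition P [set: 'I_k] -> #|P| <= k.
Proof.
move=> pP; have := card_partition pP; rewrite cardsT card_ord => e.
rewrite [X in _ <= X]e -[#|P|]sum1_card; apply: leq_sum => B BP; rewrite card_gt0.
by case/and3P: pP => _ _; apply: contraNneq => <-.
Qed.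

(** Functions from a k-set to an x-set, sorted by their fibres. *)
Lemma powers_stirling2 k x : x ^ k = \sum_(j < k.+1) stirling2 k j * x ^_ j.
Proof.
rewrite -[x in LHS]card_ord -[k in LHS]card_ord -card_ffun -sum1_card.
rewrite (partition_big (@kernel k x) (fun P => finset.partition P [set: 'I_k])) /=; last first.
  by move=> f _; apply: preim_partitionP.
transitivity (\sum_(P : {set {set 'I_k}} | finset.partition P [set: 'I_k]) x ^_ #|P|).
  apply: eq_bigr => P pP; rewrite -card_kernel // -sum1_card.
  by apply: eq_bigl => f; rewrite inE.
have cP P : finset.partition P [set: 'I_k] -> #|P| < k.+1.
  exact: card_partition_ord.
rewrite (partition_big (fun P : {set {set 'I_k}} => inord #|P| : 'I_k.+1) predT) //=.
apply: eq_bigr => j _; rewrite /stirling2 -sum_nat_const.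
apply: eq_big => P; rewrite ?inE; last by case/andP=> pP /eqP<-; rewrite inordK ?cP.
by case: (boolP (finset.partition P _)) => //= pP; rewrite -val_eqE /= inordK ?cP.
Qed.

(** Both families expand x^k in falling factorials, and these are triangular: at
    x = j the terms beyond j vanish and the term j has the factor j!. *)
Lemma stirling2E k j : stirling2 k j = stirling_rec k j.
Proof.
have [kj|] := ltnP k j; last first.
  elim/ltn_ind: j => j IH jk.
  have : \sum_(i < k.+1) stirling2 k i * j ^_ i = \sum_(i < k.+1) stirling_rec k i * j ^_ i.
    by rewrite -powers_stirling2 -powers_ffact.
  have jk1 : j < k.+1 by [].
  rewrite (bigD1 (Ordinal jk1)) //= [X in _ = X](bigD1 (Ordinal jk1)) //= ffactnn.
  rewrite (eq_bigr (fun i : 'I_k.+1 => stirling_rec k i * j ^_ i)).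
    by move/addIn/eqP; rewrite eqn_pmul2r ?fact_gt0 // => /eqP.
  move=> i ij; have [ji|ij'|e] := ltngtP j i.
  - by rewrite ffact_small // !muln0.
  - by rewrite IH // (leq_trans (ltnW ij') jk).
  - by move: ij; rewrite -val_eqE /= e eqxx.
rewrite stirling_rec_small //; apply: eq_card0 => P; rewrite inE; apply/negP=> /andP[pP /eqP cP].
by have := card_partition_ord pP; rewrite cP leqNgt kj.
Qed.

(** * Tableaux and row insertion *)

Definition grid_row_lt (f : nat -> nat -> nat) :=
  forall i j, f i j.+1 != 0 -> f i j < f i j.+1.
Definition grid_col_lt (f : nat -> nat -> nat) :=
  forall i j, f i.+1 j != 0 -> 0 < f i j < f i.+1 j.

(** A positive entry distinguishes a box from the default value 0 of entry. *)
Definition wf (T : tableau) := ([::] \notin T) && (0 \notin flatten T).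

(** The column condition includes that the box above a box exists, hence that the
    shape is a partition. *)
Definition is_tableau (T : tableau) :=
  [/\ wf T, grid_row_lt (entry T) & grid_col_lt (entry T)].

(** The column condition between a row R and the first row of T. *)
Definition row_over (R : seq nat) (T : tableau) :=
  forall j, nth 0 (nth [::] T 0) j != 0 -> 0 < nth 0 R j < nth 0 (nth [::] T 0) j.

Definition row_incr (R : seq nat) :=
  forall j, nth 0 R j.+1 != 0 -> nth 0 R j < nth 0 R j.+1.

Lemma wf_cons R T : wf (R :: T) = [&& R != [::], 0 \notin R & wf T].
Proof. by rewrite /wf inE negb_or mem_cat negb_or eq_sym andbACA !andbA. Qed.

Lemma is_tableau_cons R T :
  is_tableau (R :: T) <->
  [/\ [&& R != [::], 0 \notin R & wf T], row_incr R, row_over R T & is_tableau T].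
Proof.
split=> [[]|[w ri ro [wT rT cT]]].
  rewrite wf_cons => w r c; have /and3P[_ _ wT] := w; split=> //.
  - exact: (r 0).
  - exact: (c 0).
  - by split=> // [i|i]; [apply: (r i.+1)|apply: (c i.+1)].
split; first by rewrite wf_cons.
  by case=> [|i]; [exact: ri | exact: rT].
by case=> [|i]; [exact: ro | exact: cT].
Qed.

Lemma is_tableau_nil : is_tableau [::].
Proof. by split=> // i j; rewrite /entry !nth_nil. Qed.

Lemma entry_neq0 T i j : wf T -> (entry T i j != 0) = (j < size (nth [::] T i)).
Proof.
case/andP=> _ T0; have [js|js] := ltnP j; last by rewrite /entry nth_default.
apply: contra T0 => /eqP e; apply/flattenP; exists (nth [::] T i).
  by apply: mem_nth; rewrite ltnNge; apply: contraL js => h; rewrite nth_default.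
by rewrite -e; apply: mem_nth.
Qed.

Lemma nth_shape T i : nth 0 (shape_of T) i = size (nth [::] T i).
Proof.
have [h|h] := ltnP i (size T); first by rewrite (nth_map [::]).
by rewrite !nth_default // size_map.
Qed.

Lemma shape_part T : is_tableau T -> is_part (shape_of T).
Proof.
case=> wT _ cT; apply/is_partP; split=> [|i].
  apply/negP=> /mapP[R RT] /esym/size0nil R0; case/andP: wT.
  by rewrite -R0 RT.
rewrite !nth_shape leqNgt; apply/negP=> h.
have := cT i (size (nth [::] T i)); rewrite entry_neq0 // h => /(_ isT) /andP[].
by rewrite lt0n entry_neq0 // ltnn.
Qed.

Lemma sumn_shape T : sumn (shape_of T) = size (flatten T).
Proof. by rewrite size_flatten. Qed.

Lemma row_sorted R : 0 \notin R -> row_incr R -> sorted ltn R.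
Proof.
move=> R0 ri; apply/(sortedP 0) => i hi; apply: ri.
by apply: contra R0 => /eqP <-; apply: mem_nth.
Qed.

(** Where x enters the row R; it is the end of R when nothing is bumped. *)
Definition slot x (R : seq nat) := find (fun z => x < z) R.

Lemma slot_size x R : slot x R <= size R. Proof. exact: find_size. Qed.

Lemma nth_slot x R : slot x R < size R -> x < nth 0 R (slot x R).
Proof. by rewrite -has_find => h; apply: (@nth_find _ 0 (fun z => x < z)). Qed.

Lemma before_slot x R j : x \notin R -> j < slot x R -> nth 0 R j < x.
Proof.
move=> xR h; have := before_find 0 h; rewrite ltnNge => /negbFE.
rewrite leq_eqVlt => /predU1P[e|//]; case/negP: xR; rewrite -e mem_nth //.
exact: leq_trans h (slot_size _ _).
Qed.

Lemma sorted_nth_lt R i j : sorted ltn R -> i < j -> j < size R ->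
  nth 0 R i < nth 0 R j.
Proof.
by move=> sR ij jR; apply: (sorted_ltn_nth ltn_trans) => //; rewrite inE; lia.
Qed.

Lemma set_nth_size (T : Type) (x0 x : T) s : set_nth x0 s (size s) x = rcons s x.
Proof. by elim: s => //= a s ->. Qed.

(** Appending is the case of bumping at position size R, so set_nth describes the
    new row in both cases. *)
Lemma rsk_insert_cons x R T :
  rsk_insert x (R :: T) =
  set_nth 0 R (slot x R) x ::
    if slot x R < size R then rsk_insert (nth 0 R (slot x R)) T else T.
Proof.
rewrite /= -has_find -/(slot x R); case: ifP => // h.
by rewrite /slot hasNfind ?h // set_nth_size.
Qed.

Lemma rsk_insert_head x T :
  nth [::] (rsk_insert x T) 0 =
  set_nth 0 (nth [::] T 0) (slot x (nth [::] T 0)) x.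
Proof. by case: T => [//|R T]; rewrite rsk_insert_cons. Qed.

Lemma count_set_nth (T : Type) (a : pred T) x0 s i x : i < size s ->
  count a (set_nth x0 s i x) + a (nth x0 s i) = count a s + a x.
Proof.
elim: s i => [//|b s IH] [|i] /= h; first by lia.
by have := IH i h; lia.
Qed.

Lemma perm_slot x R : slot x R < size R ->
  perm_eq (nth 0 R (slot x R) :: set_nth 0 R (slot x R) x) (x :: R).
Proof.
by move=> h; apply/seq.permP=> a; rewrite /= addnC count_set_nth // addnC.
Qed.

Lemma slot_row_incr x R : x \notin R -> row_incr R ->
  row_incr (set_nth 0 R (slot x R) x).
Proof.
move=> xR ri j; rewrite !nth_set_nth /=; case: (eqVneq j.+1 _) => [jq _|jq].
  by rewrite (_ : (j == _) = false) ?before_slot -?jq //; lia.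
case: (eqVneq j _) => [->|_]; last exact: ri.
move=> nz; have qR : (slot x R).+1 < size R.
  by rewrite ltnNge; apply: contra nz => h; rewrite nth_default.
by apply: ltn_trans (nth_slot _) (ri _ nz); apply: ltnW.
Qed.

(** The bumped entry y goes at most as far to the right as the place p it came
    from, because the entry below p exceeds y. There the row above has an entry
    smaller than y. *)
Lemma row_over_insert x P T : 0 < x -> 0 \notin P -> sorted ltn P ->
  slot x P < size P -> row_over P T -> 0 \notin nth [::] T 0 ->
  nth 0 P (slot x P) \notin nth [::] T 0 ->
  row_over (set_nth 0 P (slot x P) x) (rsk_insert (nth 0 P (slot x P)) T).
Proof.
move=> x0 P0 sP pP PT Q0 yQ j; rewrite rsk_insert_head.
set y := nth 0 P _ in yQ *; set p := slot x P in pP y yQ *.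
set Q := nth [::] T 0 in Q0 yQ *; have xy : x < y by apply: nth_slot.
have qp : slot y Q <= p.
  rewrite leqNgt; apply/negP=> pq; have := before_slot yQ pq.
  have /PT/andP[_] : nth 0 Q p != 0; last by rewrite -/y -/Q; lia.
  by apply: contra Q0 => /eqP<-; apply: mem_nth; apply: leq_trans pq (slot_size _ _).
rewrite !nth_set_nth /=; case: (eqVneq j (slot y Q)) => [->|_] nz.
  case: (eqVneq (slot y Q) p) => [_|ne]; first by rewrite x0.
  have qp' : slot y Q < p by rewrite ltn_neqAle ne.
  rewrite (sorted_nth_lt sP qp' pP) andbT lt0n.
  apply: contra P0 => /eqP<-; apply: mem_nth; exact: ltn_trans qp' pP.
have := PT _ nz; rewrite -/Q; case: (eqVneq j p) => [->|//].
by rewrite -/y x0; lia.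
Qed.

Lemma rsk_insert_spec x T : is_tableau T -> 0 < x -> uniq (x :: flatten T) ->
  [/\ is_tableau (rsk_insert x T),
      perm_eq (flatten (rsk_insert x T)) (x :: flatten T)
    & exists r, shape_of (rsk_insert x T) = incr_nth (shape_of T) r].
Proof.
elim: T x => [|R T IH] x; first move=> _ x0 _; first split=> //=.
- apply/is_tableau_cons; split=> //.
  + by case: x x0.
  + by case=> [|j]; rewrite /= ?nth_nil.
  + by case.
  + exact: is_tableau_nil.
- by exists 0.
move/is_tableau_cons=> [/and3P[Rn R0 wT] ri ro tT] x0.
have fl : flatten (R :: T) = R ++ flatten T by [].
rewrite fl cons_uniq mem_cat negb_or cat_uniq.
case/andP=> /andP[xR xT] /and3P[uR /hasPn RT uT]; rewrite rsk_insert_cons.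
have R'n : set_nth 0 R (slot x R) x != [::].
  by rewrite -size_eq0 size_set_nth maxnC; case: (size R) => //= n; rewrite /maxn; case: ifP.
have R'0 : 0 \notin set_nth 0 R (slot x R) x.
  apply/negP=> /nthP -/(_ 0)[j]; rewrite size_set_nth nth_set_nth /= => jR.
  case: eqVneq => [_|]; first by lia.
  move=> jq e; case/negP: R0; rewrite -e mem_nth //.
  move: jR; rewrite leq_max ltnS leq_eqVlt (negPf jq) /= => /orP[h|//].
  exact: leq_trans h (slot_size _ _).
have ri' := slot_row_incr xR ri; have sR := row_sorted R0 ri.
have [qR|Rq] := ltnP (slot x R) (size R).
  set y := nth 0 R (slot x R); have yR : y \in R by apply: mem_nth.
  have yT : y \notin flatten T by apply/negP=> /RT; rewrite /= yR.
  have y0 : 0 < y by apply: leq_ltn_trans (nth_slot qR).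
  have [tT' pT' [r sT']] := IH y tT y0 (introT andP (conj yT uT)).
  split.
  - apply/is_tableau_cons; split=> //; first by rewrite R'n R'0; case: tT'.
    apply: row_over_insert => //.
      case/andP: wT => _; apply: contra; case: (T) => [//|Q T2] /= h.
      by rewrite mem_cat h.
    by move: yT; case: (T) => [//|Q T2] /=; rewrite mem_cat negb_or => /andP[].
  - rewrite [flatten (_ :: _)]/= (permPl (perm_cat (perm_refl _) pT')).
    rewrite -[y :: _]cat1s perm_catCA.
    exact: (perm_cat (perm_slot qR) (perm_refl (flatten T))).
  exists r.+1; rewrite /= sT' size_set_nth.
  by rewrite (maxn_idPr qR).
have eq : slot x R = size R by apply/eqP; rewrite eqn_leq slot_size.
split.
- apply/is_tableau_cons; split=> //; first by rewrite R'n R'0.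
  move=> j nz; rewrite nth_set_nth /=; have := ro _ nz.
  case: eqP => // ->; rewrite eq [nth 0 R _]nth_default //.
- rewrite eq set_nth_size; apply: (@perm_cat _ _ (x :: R)) (perm_refl _).
  by rewrite perm_rcons.
by exists 0; rewrite /= eq set_nth_size size_rcons.
Qed.
Lemma slotE z R q : q < size R -> (forall j, j < q -> nth 0 R j <= z) ->
  z < nth 0 R q -> slot z R = q.
Proof.
move=> qR le lt; have [h|h|//] := ltngtP (slot z R) q.
  by have := nth_slot (ltn_trans h qR); rewrite ltnNge le.
by have := before_find 0 h; rewrite lt.
Qed.

Lemma notin0_set_nth R q y : 0 \notin R -> 0 < y -> q < size R ->
  0 \notin set_nth 0 R q y.
Proof.
move=> R0 y0 qR; apply/negP=> /(nthP 0)[j]; rewrite size_set_nth (maxn_idPr qR).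
rewrite nth_set_nth /=; case: eqP => [_ _ e|_ jR e]; first by rewrite e in y0.
by case/negP: R0; rewrite -e mem_nth.
Qed.

Lemma part_behead l : is_part l -> is_part (behead l).
Proof.
case: l => // a l /andP; rewrite inE negb_or => -[/andP[_ l0] /path_sorted sl].
exact/andP.
Qed.

Lemma notin0_row T i : wf T -> 0 \notin nth [::] T i.
Proof.
move=> wT; apply/negP=> /(nthP 0)[j jT e].
by have := entry_neq0 i j wT; rewrite jT /entry e.
Qed.

Lemma mem_row (T : tableau) i x : x \in nth [::] T i -> x \in flatten T.
Proof.
elim: T i => [|R T IH] [|i] //=; rewrite mem_cat; first by move->.
by move/IH->; rewrite orbT.
Qed.

Lemma row_sorted_tableau T i : is_tableau T -> sorted ltn (nth [::] T i).
Proof. by case=> wT rT _; apply: row_sorted (rT i); apply: notin0_row. Qed.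

Lemma is_tableau_take R y T : is_tableau (rcons R y :: T) -> R != [::] ->
  size (nth [::] T 0) <= size R -> is_tableau (R :: T).
Proof.
case/is_tableau_cons=> /and3P[_ Ry0 wT] ri ro tT Rn sT.
have nR j : j < size R -> nth 0 (rcons R y) j = nth 0 R j by rewrite nth_rcons => ->.
apply/is_tableau_cons; split=> //.
- by rewrite Rn wT andbT; apply: contra Ry0; rewrite mem_rcons inE orbC => ->.
- move=> j nz; have jR : j.+1 < size R.
    by rewrite ltnNge; apply: contra nz => h; rewrite nth_default.
  by rewrite -(nR _ jR) -(nR j (ltnW jR)); apply: ri; rewrite nR.
- move=> j nz; have jT : j < size R.
    by apply: leq_trans sT; rewrite ltnNge; apply: contra nz => h; rewrite nth_default.
  by rewrite -(nR _ jT); apply: ro.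
Qed.

(** Row insertion is undone from the removed corner upwards. An entry y that leaves
    a row goes to the row above, where it replaces the largest entry smaller than
    y; that entry is bumped in turn. The entry above the place of y shows that such
    an entry exists and that it lies weakly to the right of that place. *)
Lemma rsk_reverse r S l : is_tableau S -> uniq (flatten S) -> is_part l ->
  shape_of S = incr_nth l r ->
  exists y L, [/\ is_tableau L, shape_of L = l, 0 < y,
                 perm_eq (flatten S) (y :: flatten L) & rsk_insert y L = S].
Proof.
elim: S r l => [|R T IH] r l tS uS pl.
  by move/(congr1 size); rewrite /= size_incr_nth; case: ifP => //; case: (l).
have /is_tableau_cons[/and3P[Rn R0 wT] ri ro tT] := tS.
have sR := row_sorted R0 ri; case: r => [|r] sh.
  case/lastP: R => [//|R y] in Rn R0 ri ro sR tS uS sh *.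
  have yp : 0 < y by rewrite lt0n; apply: contra R0 => /eqP<-; rewrite mem_rcons mem_head.
  have slR : slot y R = size R.
    apply/hasNfind/hasPn => z /(nthP 0)[j jR <-]; rewrite -leqNgt ltnW //.
    have := @sorted_nth_lt _ j (size R) sR jR; rewrite size_rcons => /(_ (leqnn _)).
    by rewrite !nth_rcons jR ltnn eqxx.
  have sh' i : size (nth [::] (rcons R y :: T) i) = (0 == i) + nth 0 l i.
    by rewrite -nth_incr_nth -sh nth_shape.
  have sR0 : size R = nth 0 l 0 by have := sh' 0; rewrite /= size_rcons => -[].
  have [R_nil|Rn'] := eqVneq R [::].
    have l_nil : l = [::].
      by case: l pl sR0 {sh sh'} => // a l /andP[/negP a0 _]; rewrite R_nil /= => e; 
         case: a0; rewrite -e mem_head.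
    have T_nil : T = [::] by move: sh; rewrite l_nil /=; case: (T).
    exists y, [::]; split=> //; first exact: is_tableau_nil.
      by rewrite R_nil T_nil.
    by rewrite R_nil T_nil.
  exists y, (R :: T); split=> //.
  - apply: is_tableau_take tS _ _ => //.
    by have := sh' 1; rewrite /= => ->; rewrite sR0 add0n; case/is_partP: pl.
  - apply: (@eq_from_nth _ 0) => [|i _].
      by move: sh => /(congr1 size); rewrite /= size_incr_nth; case: (l) sR0 Rn' => [/size0nil->|].
    have := sh' i; rewrite nth_shape; case: i => [|i] /=; last by rewrite add0n.
    by rewrite size_rcons => -[].
  - by apply: (@perm_cat _ _ (y :: R)) (perm_refl _); rewrite perm_rcons.
  - by rewrite rsk_insert_cons slR ltnn set_nth_size.
case: l pl sh => [|a l] pl /=.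
  by case=> /size0nil R_nil; rewrite R_nil in Rn.
case=> sRa sT; have pl' := part_behead pl.
have uT : uniq (flatten T) by move: uS; rewrite /= cat_uniq => /and3P[].
have [y [T' [tT' sT' y0 pT eT]]] := IH r l tT uT pl' sT.
have yR : y \notin R.
  move: uS; rewrite /= cat_uniq => /and3P[_ /hasPn h _]; apply: h.
  by rewrite (perm_mem pT) mem_head.
pose Q := nth [::] T' 0; pose p := slot y Q.
have hT : nth [::] T 0 = set_nth 0 Q p y by rewrite -eT rsk_insert_head.
have Rp : 0 < nth 0 R p < y.
  by have := ro p; rewrite hT nth_set_nth /= eqxx; apply; rewrite -lt0n.
have pR : p < size R.
  by rewrite ltnNge; apply/negP=> h; move: Rp; rewrite nth_default.
(* The entries of R smaller than y are the first f ones, and q is the last of them. *)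
pose f := find (fun z => y <= z) R.
have fR : f <= size R by apply: find_size.
have pf : p < f.
  rewrite ltnNge; apply/negP=> fp.
  have hf : has (fun z => y <= z) R by rewrite has_find; apply: leq_ltn_trans pR.
  have := nth_find 0 hf; rewrite -/f; case: (ltngtP f p) fp => // [fp|->] _.
    by have := sorted_nth_lt sR fp pR; lia.
  by lia.
pose q := f.-1; have fq : f = q.+1 by rewrite /q; lia.
have qR : q < size R by rewrite -fq.
have Rq : nth 0 R q < y.
  rewrite ltnNge; apply/negbT/(@before_find _ 0 (fun z => y <= z)).
  by rewrite -/f fq.
pose R' := set_nth 0 R q y; have sR' : size R' = size R by rewrite size_set_nth (maxn_idPr qR).
exists (nth 0 R q), (R' :: T'); split.
- apply/is_tableau_cons; split=> //.
  + apply/and3P; split; [by rewrite -size_eq0 sR' size_eq0 | | by case: tT'].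
    exact: notin0_set_nth.
  + move=> j; rewrite !nth_set_nth /=; case: (eqVneq j.+1 q) => [jq _|jq].
      rewrite (_ : (j == q) = false); last by lia.
      by apply: ltn_trans Rq; apply: sorted_nth_lt => //; rewrite -jq.
    case: (eqVneq j q) => [->|_] nz; last exact: ri.
    have fR' : f < size R.
      by rewrite ltnNge; apply: contra nz => h; rewrite nth_default // -fq.
    have := @nth_find _ 0 (fun z => y <= z) R; rewrite has_find -/f fR' => /(_ isT).
    rewrite leq_eqVlt -fq => /predU1P[e|//].
    by case/negP: yR; rewrite e mem_nth.
  + move=> j; rewrite -/Q nth_set_nth /= => nz.
    have jQ : j < size Q by rewrite ltnNge; apply: contra nz => h; rewrite nth_default.
    have := ro j; rewrite hT nth_set_nth /=; case: (eqVneq j p) => [jp _|jp /(_ nz) h].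
      have yQ : y < nth 0 Q j by rewrite jp; apply: nth_slot; rewrite -/p -jp.
      by case: eqP => _; rewrite ?y0 //; move: Rp yQ; rewrite -jp => /andP[-> /ltn_trans h] /h.
    case: (eqVneq j q) => [jq|//]; rewrite y0 /=.
    have pj : p < j by lia.
    have sQ : sorted ltn Q by apply: row_sorted_tableau.
    apply: ltn_trans (nth_slot (ltn_trans pj jQ)) _; exact: sorted_nth_lt.
- by rewrite /= sR' sRa sT'.
- rewrite lt0n; apply: contra R0 => /eqP<-; exact: mem_nth.
- rewrite [flatten (_ :: _)]/= (permPl (perm_cat (perm_refl _) pT)).
  rewrite -[y :: _]cat1s perm_catCA.
  apply: (@perm_cat _ (y :: R) (_ :: R')) (perm_refl _).
  by apply/seq.permP=> b; rewrite /= addnC -(count_set_nth b 0 y qR) addnC.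
- have sl : slot (nth 0 R q) R' = q.
    apply: slotE; rewrite ?sR' //; last by rewrite nth_set_nth /= eqxx.
    by move=> j jq; rewrite nth_set_nth /= (ltn_eqF jq) ltnW // sorted_nth_lt.
  rewrite rsk_insert_cons sl sR' qR nth_set_nth /= eqxx eT; congr (_ :: _).
  apply: (@eq_from_nth _ 0) => [|j _]; first by rewrite size_set_nth sR' (maxn_idPr qR).
  by rewrite nth_set_nth /=; case: (eqVneq j q) => [->|jq] //; rewrite nth_set_nth /= (negPf jq).
Qed.

(** * Jeu de taquin *)

(** The row conditions of a grid in which the entry at (i, j) is disregarded: its
    two neighbours in the row are compared with each other instead. *)
Definition row_hole_ok (f : nat -> nat -> nat) i j :=
  [/\ forall a b, f a b.+1 != 0 -> f a b != 0,
      forall a b, (a, b) != (i, j) -> (a, b.+1) != (i, j) ->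
        f a b.+1 != 0 -> f a b < f a b.+1
    & forall b, j = b.+1 -> f i j.+1 != 0 -> f i b < f i j.+1].

(** The state of a slide that has its moving entry at (i, j). The two halves are
    exchanged by transposition, which turns the moves to the right into the moves
    down and those to the left into those up. *)
Definition hole_ok f i j :=
  [/\ f i j != 0, row_hole_ok f i j & row_hole_ok (fun a b => f b a) j i].

(** The state of a backward slide, where the moving entry is too small for its place
    but not too large. *)
Definition small_hole_ok f i j :=
  [/\ hole_ok f i j, f i j.+1 != 0 -> f i j < f i j.+1
    & f i.+1 j != 0 -> f i j < f i.+1 j].

Definition swap (f : nat -> nat -> nat) i j i' j' a b :=
  if (a, b) == (i', j') then f i j
  else if (a, b) == (i, j) then f i' j' else f a b.

Ltac pair_neq := by rewrite xpair_eqE; lia.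

Lemma row_hole_ok_ext f g i j : (forall a b, f a b = g a b) ->
  row_hole_ok f i j -> row_hole_ok g i j.
Proof.
move=> fg [h1 h2 h3]; split=> [a b|a b|b].
- rewrite -!fg; exact: h1.
- rewrite -!fg; exact: h2.
- rewrite -!fg; exact: h3.
Qed.

Lemma hole_ok_ext f g i j : (forall a b, f a b = g a b) ->
  hole_ok f i j -> hole_ok g i j.
Proof.
move=> fg [h1 h2 h3]; split; first by rewrite -fg.
  exact: row_hole_ok_ext h2.
by apply: row_hole_ok_ext h3.
Qed.

Lemma hole_ok_tr f i j : hole_ok f i j -> hole_ok (fun a b => f b a) j i.
Proof. by case=> h1 h2 h3; split. Qed.

Lemma swap_tr f i j i' j' a b :
  swap (fun a b => f b a) j i j' i' b a = swap f i j i' j' a b.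
Proof. by rewrite /swap !xpair_eqE !(andbC (b == _)). Qed.

Lemma swap_neq0 f i j i' j' a b : f i j != 0 -> f i' j' != 0 ->
  (swap f i j i' j' a b != 0) = (f a b != 0).
Proof.
move=> h h'; rewrite /swap; case: (eqVneq (a, b) (i', j')) => [[-> ->]|_]; first by rewrite h h'.
by case: (eqVneq (a, b) (i, j)) => [[-> ->]|//]; rewrite h h'.
Qed.

Lemma swapR f i j i' j' : swap f i j i' j' i' j' = f i j.
Proof. by rewrite /swap eqxx. Qed.

Lemma swapL f i j i' j' : (i, j) != (i', j') -> swap f i j i' j' i j = f i' j'.
Proof. by move=> n; rewrite /swap (negPf n) eqxx. Qed.

Lemma swapD f i j i' j' a b : (a, b) != (i', j') -> (a, b) != (i, j) ->
  swap f i j i' j' a b = f a b.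
Proof. by move=> n n'; rewrite /swap (negPf n) (negPf n'). Qed.

(** The right neighbour may replace the moving entry because it is smaller than the
    one below. *)
Lemma hole_right f i j : hole_ok f i j -> f i j.+1 != 0 ->
  (f i.+1 j != 0 -> f i j.+1 < f i.+1 j) ->
  hole_ok (swap f i j i j.+1) i j.+1.
Proof.
move=> [fx [r1 r2 r3] [c1 c2 c3]] fr lt; split.
- by rewrite swapR.
- split=> [a b|a b n1 n2|b [<-]]; rewrite ?swap_neq0 //; first exact: r1.
    move=> nz; case: (eqVneq (a, b) (i, j)) => [[ai bj]|n3].
      by rewrite ai bj eqxx in n2.
    rewrite swapD //; case: (eqVneq (a, b.+1) (i, j)) => [[ai bj]|n4].
      by rewrite ai bj swapL; [apply: r3 | pair_neq].
    by rewrite swapD //; apply: r2.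
  move=> nz; rewrite swapL ?swapD; try pair_neq.
  by apply: r2 => //; pair_neq.
- split=> [a b|a b n1 n2|b ib]; rewrite ?swap_neq0 //; first exact: c1.
    move=> nz; case: (eqVneq (b, a) (i, j)) => [[bi aj]|n3].
      move: nz; rewrite bi aj => nz; rewrite swapL; last by pair_neq.
      by rewrite swapD; [apply: lt | pair_neq | pair_neq].
    have n1' : (b, a) != (i, j.+1) by move: n1; rewrite !xpair_eqE andbC.
    have n2' : (b.+1, a) != (i, j.+1) by move: n2; rewrite !xpair_eqE andbC.
    rewrite swapD //; case: (eqVneq (b.+1, a) (i, j)) => [[bi aj]|n4].
      rewrite bi aj swapL; last by pair_neq.
      have nz' : f b j.+1 != 0 by apply: (c1 j.+1); rewrite bi.
      apply: (@ltn_trans (f b j.+1)); first by apply: r2 => //; pair_neq.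
      by rewrite -bi; apply: (c2 j.+1); rewrite ?bi //; pair_neq.
    rewrite swapD //; apply: (c2 a) => //.
      by move: n3; rewrite !xpair_eqE andbC.
    by move: n4; rewrite !xpair_eqE andbC.
  move=> nz; rewrite swapD; [|pair_neq|pair_neq].
  rewrite (@swapD _ _ _ _ _ i.+1); [|pair_neq|pair_neq].
  have nz' : f i.+1 j.+1 != 0 := nz.
  apply: (@ltn_trans (f i j.+1)).
    by rewrite ib; apply: (c2 j.+1); rewrite -?ib //; pair_neq.
  by apply: (c2 j.+1) => //; pair_neq.
Qed.

Lemma hole_down f i j : hole_ok f i j -> f i.+1 j != 0 ->
  (f i j.+1 != 0 -> f i.+1 j < f i j.+1) ->
  hole_ok (swap f i j i.+1 j) i.+1 j.
Proof.
move=> /hole_ok_tr h nz lt; have /hole_ok_tr := hole_right h nz lt.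
by apply: hole_ok_ext => a b; rewrite swap_tr.
Qed.

Lemma small_hole_ok_tr f i j :
  small_hole_ok f i j -> small_hole_ok (fun a b => f b a) j i.
Proof. by case=> /hole_ok_tr h1 h2 h3; split. Qed.

Lemma small_hole_ok_ext f g i j : (forall a b, f a b = g a b) ->
  small_hole_ok f i j -> small_hole_ok g i j.
Proof.
move=> fg [h1 h2 h3]; split; first exact: hole_ok_ext h1.
  by rewrite -!fg.
by rewrite -!fg.
Qed.

(** The left neighbour may replace the moving entry because it is larger than the
    one above. *)
Lemma small_hole_left f i j : small_hole_ok f i j.+1 -> f i j.+1 < f i j ->
  (forall a, i = a.+1 -> f a j.+1 < f i j) ->
  small_hole_ok (swap f i j.+1 i j) i j.
Proof.
move=> [[fx [r1 r2 r3] [c1 c2 c3]] xr xb] xl ul.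
have fl : f i j != 0 by apply: r1.
have cj a : i = a.+1 -> f a j < f i j.
  by move=> ia; rewrite ia; apply: (c2 j); rewrite -?ia //; pair_neq.
have fd : f i.+1 j != 0 -> f i j < f i.+1 j.
  by move=> nz; apply: (c2 j) => //; pair_neq.
split; [split| |].
- by rewrite swapR.
- split=> [a b|a b n1 n2|b jb]; rewrite ?swap_neq0 //; first exact: r1.
    move=> nz; case: (eqVneq (a, b) (i, j.+1)) => [[ai bj]|n3].
      move: nz; rewrite ai bj => nz; rewrite swapL; last by pair_neq.
      by rewrite swapD; [apply: r3 | pair_neq | pair_neq].
    rewrite swapD //; case: (eqVneq (a, b.+1) (i, j.+1)) => [[ai bj]|n4].
      by rewrite ai bj eqxx in n1.
    by rewrite swapD //; apply: r2.
  move=> _; rewrite swapL ?swapD; try pair_neq.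
  by rewrite jb; apply: r2; rewrite -?jb //; pair_neq.
- split=> [a b|a b n1 n2|b ib]; rewrite ?swap_neq0 //; first exact: c1.
    move=> nz.
    have n1' : (b, a) != (i, j) by move: n1; rewrite !xpair_eqE andbC.
    have n2' : (b.+1, a) != (i, j) by move: n2; rewrite !xpair_eqE andbC.
    case: (eqVneq (b, a) (i, j.+1)) => [[bi aj]|n3].
      move: nz; rewrite bi aj => nz; rewrite swapL; last by pair_neq.
      have nz' : f i.+1 j != 0 by apply: r1.
      rewrite swapD; [|pair_neq|pair_neq].
      by apply: ltn_trans (fd nz') _; apply: r2 => //; pair_neq.
    rewrite swapD //; case: (eqVneq (b.+1, a) (i, j.+1)) => [[bi aj]|n4].
      by rewrite bi aj swapL; [apply: ul | pair_neq].
    rewrite swapD //; apply: (c2 a) => //.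
      by move: n3; rewrite !xpair_eqE andbC.
    by move: n4; rewrite !xpair_eqE andbC.
  move=> nz; rewrite swapD; [|pair_neq|pair_neq].
  rewrite (@swapD _ _ _ _ _ i.+1); [|pair_neq|pair_neq].
  by apply: ltn_trans (cj _ ib) (fd nz).
- by rewrite swapR swapL //; pair_neq.
- rewrite swapR swapD; [|pair_neq|pair_neq].
  by move=> /fd; apply: ltn_trans.
Qed.

Lemma small_hole_up f i j : small_hole_ok f i.+1 j -> f i.+1 j < f i j ->
  (forall b, j = b.+1 -> f i.+1 b < f i j) ->
  small_hole_ok (swap f i.+1 j i j) i j.
Proof.
move=> /small_hole_ok_tr h lt ul; have /small_hole_ok_tr := small_hole_left h lt ul.
by apply: small_hole_ok_ext => a b; rewrite swap_tr.
Qed.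

Lemma small_hole_done f i j : small_hole_ok f i j ->
  (forall b, j = b.+1 -> f i b < f i j) ->
  (forall a, i = a.+1 -> f a j < f i j) ->
  grid_row_lt f /\ grid_col_lt f.
Proof.
move=> [[fx [r1 r2 r3] [c1 c2 c3]] xr xb] xl xu; split=> a b nz.
  case: (eqVneq (a, b) (i, j)) => [[ai bj]|n1]; first by move: nz; rewrite ai bj.
  case: (eqVneq (a, b.+1) (i, j)) => [[ai bj]|n2]; last exact: r2.
  by rewrite bj ai; apply: xl.
rewrite lt0n c1 //=.
case: (eqVneq (a, b) (i, j)) => [[ai bj]|n1]; first by move: nz; rewrite ai bj.
case: (eqVneq (a.+1, b) (i, j)) => [[ai bj]|n2]; first by rewrite ai bj; apply: xu.
by apply: (c2 b); rewrite // xpair_eqE andbC -xpair_eqE.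
Qed.

Lemma grid_hole_ok f i j : grid_row_lt f -> grid_col_lt f ->
  (forall a b, f a b.+1 != 0 -> f a b != 0) -> f i j != 0 -> hole_ok f i j.
Proof.
move=> rf cf f0 fx; split=> //; split=> [a b|a b _ _|b jb].
- exact: f0.
- exact: rf.
- by move=> nz; apply: ltn_trans (rf _ _ nz); rewrite jb; apply: rf; rewrite -jb.
- by move=> /cf/andP[]; rewrite lt0n.
- by move=> /cf/andP[].
- by move=> /cf/andP[_]; apply: ltn_trans; rewrite jb; apply: (andP (cf _ _ _)).2; rewrite -jb.
Qed.

Lemma entry_set_entry T i j v a b :
  entry (set_entry T i j v) a b = if (a, b) == (i, j) then v else entry T a b.
Proof.
rewrite /entry /set_entry nth_set_nth /= xpair_eqE; case: (eqVneq a i) => [->|//].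
by rewrite nth_set_nth.
Qed.

Lemma entry_exchange T i j i' j' a b :
  entry (exchange T i j i' j') a b = swap (entry T) i j i' j' a b.
Proof. by rewrite /exchange !entry_set_entry. Qed.

Lemma row_in_tableau (T : tableau) i j : j < size (nth [::] T i) -> i < size T.
Proof. by move=> jT; rewrite ltnNge; apply: contraL jT => h; rewrite nth_default. Qed.

Lemma shape_set_entry T i j v : j < size (nth [::] T i) ->
  shape_of (set_entry T i j v) = shape_of T.
Proof.
move=> jT; have iT := row_in_tableau jT.
apply: (@eq_from_nth _ 0) => [|a _].
  by rewrite !size_map size_set_nth (maxn_idPr iT).
rewrite !nth_shape nth_set_nth /=; case: eqP => [->|//].
by rewrite size_set_nth (maxn_idPr jT).
Qed.

Lemma entry_lt T i j : entry T i j != 0 -> j < size (nth [::] T i).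
Proof. by rewrite ltnNge; apply: contra => h; rewrite /entry nth_default. Qed.

Lemma shape_exchange T i j i' j' : entry T i j != 0 -> entry T i' j' != 0 ->
  shape_of (exchange T i j i' j') = shape_of T.
Proof.
move=> /entry_lt h /entry_lt h'; rewrite /exchange shape_set_entry.
  exact: shape_set_entry.
by rewrite -nth_shape shape_set_entry // nth_shape.
Qed.

Lemma count_flatten_set_nth (a : pred nat) (T : tableau) i R : i < size T ->
  count a (flatten (set_nth [::] T i R)) + count a (nth [::] T i) =
  count a (flatten T) + count a R.
Proof.
elim: T i => [//|Q T IH] [|i] h /=; rewrite !count_cat.
  by rewrite addnAC [RHS]addnAC addnC [in RHS]addnC; lia.
by rewrite -addnA IH // addnA.
Qed.

Lemma count_set_entry (a : pred nat) T i j v : j < size (nth [::] T i) ->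
  count a (flatten (set_entry T i j v)) + a (entry T i j) =
  count a (flatten T) + a v.
Proof.
move=> jT; have iT := row_in_tableau jT.
have := count_flatten_set_nth a (set_nth 0 (nth [::] T i) j v) iT.
have := count_set_nth a 0 v jT.
rewrite -/(entry T i j) -/(set_entry T i j v).
move: (count _ _) (count _ _) (count _ _) (count _ _) => ? ? ? ?.
by lia.
Qed.

Lemma perm_exchange T i j i' j' : entry T i j != 0 -> entry T i' j' != 0 ->
  (i, j) != (i', j') ->
  perm_eq (flatten (exchange T i j i' j')) (flatten T).
Proof.
move=> h h' n; apply/seq.permP=> a; rewrite /exchange.
have e1 := count_set_entry a (entry T i' j') (entry_lt h).
have h1 : j' < size (nth [::] (set_entry T i j (entry T i' j')) i').
  by rewrite -nth_shape shape_set_entry ?entry_lt // nth_shape entry_lt.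
have := count_set_entry a (entry T i j) h1.
by rewrite entry_set_entry eq_sym (negPf n) e1 => /addIn.
Qed.

Lemma entry_mem T i j : entry T i j != 0 -> entry T i j \in flatten T.
Proof. by move/entry_lt=> h; apply: (@mem_row _ i); apply: mem_nth. Qed.

(** Distinct entries make all comparisons of neighbours in a slide strict. *)
Lemma entry_inj T i j i' j' : uniq (flatten T) -> entry T i j != 0 ->
  entry T i j = entry T i' j' -> (i, j) = (i', j').
Proof.
elim: T i i' => [|R T IH] i i'; first by rewrite /entry !nth_nil.
rewrite [flatten _]/= cat_uniq => /and3P[uR /hasPn RT uT] nz e.
have nz' : entry (R :: T) i' j' != 0 by rewrite -e.
case: i i' => [|i] [|i'] in e nz nz' *.
- have := entry_lt nz; have := entry_lt nz'; rewrite /= => h h'.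
  by move/eqP: e; rewrite /entry /= nth_uniq // => /eqP->.
- case/negP: (RT _ (@entry_mem T _ _ nz')); rewrite -[entry T _ _]e.
  by apply: mem_nth; apply: (entry_lt nz).
- case/negP: (RT _ (@entry_mem T _ _ nz)); rewrite [entry T _ _]e.
  by apply: mem_nth; apply: (entry_lt nz').
- by case: (IH i i' uT nz e) => -> ->.
Qed.

Lemma tableau_ext S T : shape_of S = shape_of T ->
  (forall i j, entry S i j = entry T i j) -> S = T.
Proof.
move=> sh e; have sz : size S = size T by rewrite -!(size_map size) [map _ _]sh.
apply: (@eq_from_nth _ [::]) => // i _.
have szi : size (nth [::] S i) = size (nth [::] T i) by rewrite -!nth_shape sh.
by apply: (@eq_from_nth _ 0) => // j _; apply: e.
Qed.

Lemma wf_shape_perm S T : shape_of S = shape_of T ->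
  perm_eq (flatten S) (flatten T) -> wf S = wf T.
Proof.
move=> sh p; rewrite /wf (perm_mem p); congr (~~ _ && _).
have h (U : tableau) : ([::] \in U) = (0 \in shape_of U).
  apply/idP/mapP => [h|[R RU /esym/size0nil <-//]]; by exists [::].
by rewrite !h sh.
Qed.

Lemma wf_exchange T i j i' j' : entry T i j != 0 -> entry T i' j' != 0 ->
  (i, j) != (i', j') -> wf (exchange T i j i' j') = wf T.
Proof.
by move=> h h' n; rewrite (wf_shape_perm (shape_exchange h h') (perm_exchange h h' n)).
Qed.

Lemma exchangeK T i j i' j' : entry T i j != 0 -> entry T i' j' != 0 ->
  (i, j) != (i', j') -> exchange (exchange T i j i' j') i' j' i j = T.
Proof.
move=> h h' n; have n' : (i', j') != (i, j) by rewrite eq_sym.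
apply: tableau_ext => [|a b].
  by rewrite !shape_exchange // entry_exchange ?swapL ?swapR.
rewrite entry_exchange {1}/swap !entry_exchange swapR swapL //.
case: (eqVneq (a, b) (i, j)) => [[-> ->]//|n1].
case: (eqVneq (a, b) (i', j')) => [[-> ->]//|n2].
by rewrite swapD.
Qed.

(** The hook of boxes left of and above (i, j) has i + j + 1 boxes: this bounds the
    length of a slide by the number of boxes. *)
Lemma part_cell l i j : 0 \notin l -> j < nth 0 l i -> i + j < sumn l.
Proof.
elim: l i => [|a l IH] [|i] //=; rewrite inE negb_or => /andP[a0 l0] h; first by lia.
by have := IH i l0 h; lia.
Qed.

Lemma cell_bound T i j : wf T -> entry T i j != 0 -> i + j < size (flatten T).
Proof.
move=> wT /entry_lt h; rewrite -sumn_shape; apply: part_cell; last by rewrite nth_shape.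
by apply/negP=> /mapP[R RT /esym/size0nil R0]; case/andP: wT; rewrite -R0 RT.
Qed.

(** Removing empty rows does not move the other rows when only the last row can be
    empty. *)
Lemma entry_drop_empty T i j : [::] \notin behead (rev T) ->
  entry (drop_empty T) i j = entry T i j.
Proof.
case/lastP: T => [//|T R]; rewrite rev_rcons /= mem_rev => nT.
rewrite /drop_empty filter_rcons (all_filterP _); last first.
  by apply/allP=> Q QT; apply: contraNneq nT => <-.
rewrite /entry; case: eqP => [->|//] /=.
by rewrite nth_rcons; case: ltngtP => // h; rewrite [nth [::] T i]nth_default ?h // ltnW.
Qed.

Lemma flatten_drop_empty (T : tableau) : flatten (drop_empty T) = flatten T.
Proof. by elim: T => [//|R T IH] /=; case: eqP => [->|_] /=; rewrite IH. Qed.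

Lemma hole_shape_part T i j : wf T -> hole_ok (entry T) i j -> is_part (shape_of T).
Proof.
move=> wT [_ _ [c1 _ _]]; apply/is_partP; split=> [|a].
  by apply/negP=> /mapP[R RT /esym/size0nil R0]; case/andP: wT; rewrite -R0 RT.
rewrite !nth_shape leqNgt; apply/negP=> h.
have := c1 (size (nth [::] T a)) a; rewrite !entry_neq0 // h => /(_ isT).
by rewrite ltnn.
Qed.

(** The removed row part is a single box. It leaves an empty row only if it is the
    last box of the last row, because the shape is a partition. *)
Lemma remove_corner_spec T i j : wf T -> hole_ok (entry T) i j ->
  entry T i j.+1 = 0 -> entry T i.+1 j = 0 ->
  [/\ is_tableau (remove_corner T i j),
      perm_eq (flatten T) (entry T i j :: flatten (remove_corner T i j))
    & shape_of T = incr_nth (shape_of (remove_corner T i j)) i].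
Proof.
move=> wT hT e1 e2; have pT := hole_shape_part wT hT.
case: hT => fx [r1 r2 r3] [c1 c2 c3].
have jT := entry_lt fx; have iT := row_in_tableau jT.
have sj : size (nth [::] T i) = j.+1.
  by apply/eqP; rewrite eqn_leq jT andbT leqNgt -entry_neq0 // e1.
pose T1 := set_nth [::] T i (take j (nth [::] T i)).
have sT1 : size T1 = size T by rewrite size_set_nth (maxn_idPr iT).
have eT1 a b : entry T1 a b = if (a, b) == (i, j) then 0 else entry T a b.
  rewrite /entry nth_set_nth /= xpair_eqE; case: (eqVneq a i) => [->|//] /=.
  case: (ltngtP b j) => [h|h|->].
  - by rewrite nth_take.
  - rewrite [RHS]nth_default ?sj // nth_default // size_take sj ltnSn; exact: ltnW.
  - by rewrite nth_default // size_take sj ltnSn.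
have nT1 a : a.+1 < size T1 -> nth [::] T1 a != [::].
  rewrite sT1 nth_set_nth /= => aT; have wTa b : b < size T -> nth [::] T b != [::].
    by move=> bT; case/andP: wT => + _; apply: contraNneq => <-; apply: mem_nth.
  case: (eqVneq a i) => [ai|_]; last exact: wTa (ltnW aT).
  rewrite -size_eq0 size_take sj ltnSn; apply/eqP=> j0.
  have := wTa _ aT; rewrite -size_eq0 -leqn0 leqNgt -entry_neq0 // ai.
  by move: e2; rewrite j0 => ->.
have eS a b : entry (remove_corner T i j) a b = if (a, b) == (i, j) then 0 else entry T a b.
  rewrite -eT1; apply: entry_drop_empty; apply/negP=> /(nthP [::])[a'].
  rewrite size_behead size_rev => h; rewrite nth_behead nth_rev; last by lia.
  by move=> e; have := nT1 (size T1 - a'.+2); rewrite e eqxx; case: (size T1) h => // n; lia.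
have pS : perm_eq (flatten T) (entry T i j :: flatten (remove_corner T i j)).
  rewrite flatten_drop_empty; apply/seq.permP=> a.
  have := count_flatten_set_nth a (take j (nth [::] T i)) iT.
  have cR : count a (nth [::] T i) = count a (take j (nth [::] T i)) + a (entry T i j).
    by rewrite -[in LHS](cat_take_drop j (nth [::] T i)) (drop_nth 0 jT) count_cat /=
               drop_oversize ?sj // addn0.
  by rewrite cR addnCA [RHS]addnC => /addnI <-; rewrite addnC.
have wS : wf (remove_corner T i j).
  rewrite /wf mem_filter eqxx /=; case/andP: wT => _.
  by rewrite (perm_mem pS) inE negb_or => /andP[].
have tS : is_tableau (remove_corner T i j).
  split=> // a b; rewrite !eS.
    case: ifP => // n1 nz; case: (eqVneq (a, b) (i, j)) => [[ai bj]|n2].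
      by move: nz; rewrite ai bj e1.
    by apply: r2; rewrite ?n1.
  case: ifP => // n1 nz; case: (eqVneq (a, b) (i, j)) => [[ai bj]|n2].
    by move: nz; rewrite ai bj e2.
  rewrite lt0n c1 //=; apply: (c2 b) => //; first by rewrite xpair_eqE andbC -xpair_eqE.
  by rewrite xpair_eqE andbC -xpair_eqE n1.
split=> //; case/is_partP: pT => pT mono.
have szS a : size (nth [::] (remove_corner T i j) a) = size (nth [::] T a) - (a == i).
  have h b : (b < size (nth [::] (remove_corner T i j) a)) =
             (b < size (nth [::] T a) - (a == i)).
    rewrite -entry_neq0 // eS xpair_eqE; case: (eqVneq a i) => [->|_] /=.
      rewrite sj subSS subn0; case: (ltngtP b j) => h //=.
        by rewrite entry_neq0 // sj ltnW.
      by apply/negbTE; rewrite negbK -leqn0 leqNgt lt0n entry_neq0 // sj -leqNgt.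
    by rewrite subn0 entry_neq0.
  apply/eqP; rewrite eqn_leq; apply/andP; split; rewrite leqNgt.
    by rewrite h ltnn.
  by rewrite -h ltnn.
apply: part_ext => // [|a].
  suff : is_part (incr_nth (shape_of (remove_corner T i j)) i) by case/is_partP.
  rewrite part_incr ?shape_part // /addable !nth_shape !szS.
  case: (posnP i) => //= i0; have := mono i.-1; rewrite prednK // !nth_shape sj eqxx.
  by rewrite (_ : (i.-1 == i) = false); lia.
rewrite nth_incr_nth !nth_shape szS eq_sym; case: eqP => [->|]; rewrite ?subn0 //.
by rewrite sj subn1.
Qed.
Lemma jdt_slideS n T i j :
  jdt_slide n.+1 T i j =
  if (entry T i.+1 j == 0) && (entry T i j.+1 == 0) then remove_corner T i j
  else if (entry T i j.+1 == 0) ||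
          ((entry T i.+1 j != 0) && (entry T i.+1 j < entry T i j.+1)) then
    jdt_slide n (exchange T i j i.+1 j) i.+1 j
  else jdt_slide n (exchange T i j i j.+1) i j.+1.
Proof. by []. Qed.

Lemma hole_exchange T i j i' j' : hole_ok (swap (entry T) i j i' j') i' j' ->
  hole_ok (entry (exchange T i j i' j')) i' j'.
Proof. by apply: hole_ok_ext => a b; rewrite entry_exchange. Qed.

(** A hole state is preserved by each exchange and becomes a tableau when the corner
    is removed. The bound on n says that the fuel cannot run out before that. *)
Lemma jdt_slide_spec n T i j : wf T -> uniq (flatten T) ->
  hole_ok (entry T) i j -> size (flatten T) <= n + (i + j) ->
  [/\ is_tableau (jdt_slide n T i j),
      perm_eq (flatten T) (entry T i j :: flatten (jdt_slide n T i j))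
    & exists r, shape_of T = incr_nth (shape_of (jdt_slide n T i j)) r].
Proof.
elim: n T i j => [|n IH] T i j wT uT hT sz; have [fx _ _] := hT.
  by have := cell_bound wT fx; rewrite ltnNge sz.
rewrite jdt_slideS.
have [/andP[/eqP e2 /eqP e1]|ne] := boolP (_ && _).
  by have [] := remove_corner_spec wT hT e1 e2; split=> //; exists i.
have move i' j' : (i, j) != (i', j') -> entry T i' j' != 0 ->
    hole_ok (swap (entry T) i j i' j') i' j' -> i' + j' = (i + j).+1 ->
    [/\ is_tableau (jdt_slide n (exchange T i j i' j') i' j'),
      perm_eq (flatten T)
        (entry T i j :: flatten (jdt_slide n (exchange T i j i' j') i' j'))
    & exists r, shape_of T =
        incr_nth (shape_of (jdt_slide n (exchange T i j i' j') i' j')) r].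
  move=> nij fx' h' e.
  have pT := perm_exchange fx fx' nij.
  have := IH (exchange T i j i' j') i' j'; rewrite wf_exchange // (perm_uniq pT).
  rewrite (perm_size pT) e addnS => /(_ wT uT (hole_exchange h') sz).
  rewrite shape_exchange // entry_exchange swapR => -[t p s]; split=> //.
  by rewrite -(permPl pT).
case: ifP => [h|h].
  have nz : entry T i.+1 j != 0 by move: ne h; case: eqP => //= _; case: eqP.
  apply: move => //; [pair_neq | apply: hole_down => // nz'].
  by move: h; rewrite (negPf nz') nz.
have nz : entry T i j.+1 != 0 by apply: contraFneq h => ->.
apply: move => //; [pair_neq | apply: hole_right => // nz' | by rewrite addnS].
rewrite ltn_neqAle leqNgt; apply/andP; split; last first.
  by move: h; rewrite (negPf nz) nz' /= => ->.
by apply/eqP=> e; case: (entry_inj uT nz e); lia.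
Qed.

Lemma tableau_hole T i j : is_tableau T -> entry T i j != 0 ->
  hole_ok (entry T) i j.
Proof.
case=> wT rT cT; apply: grid_hole_ok => // a b; rewrite !entry_neq0 //; exact: ltnW.
Qed.

Definition pos_row x (T : tableau) := find (fun R : seq nat => x \in R) T.
Definition pos_col x (T : tableau) := index x (nth [::] T (pos_row x T)).

Lemma entry_pos x T : x \in flatten T -> entry T (pos_row x T) (pos_col x T) = x.
Proof.
case/flattenP=> R RT xR; apply: nth_index.
by apply: (@nth_find _ [::] (fun R : seq nat => x \in R)); apply/hasP; exists R.
Qed.

(** Entries are distinct, so the place found by searching for x is the only one. *)
Lemma pos_entry T i j x : uniq (flatten T) -> entry T i j != 0 -> entry T i j = x ->
  (pos_row x T, pos_col x T) = (i, j).
Proof.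
move=> uT nz e; have xT : x \in flatten T by rewrite -e entry_mem.
by have e' := entry_pos xT; apply: (entry_inj uT); rewrite e' -e.
Qed.

Lemma jdt_deleteE x T :
  jdt_delete x T = jdt_slide (size (flatten T)) T (pos_row x T) (pos_col x T).
Proof. by rewrite /jdt_delete sumn_shape. Qed.

Lemma jdt_delete_spec x T : is_tableau T -> uniq (flatten T) -> x \in flatten T ->
  [/\ is_tableau (jdt_delete x T),
      perm_eq (flatten T) (x :: flatten (jdt_delete x T))
    & exists r, shape_of T = incr_nth (shape_of (jdt_delete x T)) r].
Proof.
move=> tT uT xT; have wT : wf T by case: tT.
have ex := entry_pos xT; rewrite jdt_deleteE -{3}ex.
apply: jdt_slide_spec => //; last exact: leq_addr.
apply: tableau_hole => //; rewrite ex.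
by case/andP: wT => _; apply: contraNneq => <-.
Qed.

Lemma small_hole_exchange T i j i' j' : small_hole_ok (swap (entry T) i j i' j') i' j' ->
  small_hole_ok (entry (exchange T i j i' j')) i' j'.
Proof. by apply: small_hole_ok_ext => a b; rewrite entry_exchange. Qed.

(** A backward slide exchanges the moving entry with the larger of its left and upper
    neighbours as long as this exceeds it. The forward slide takes each of these
    steps back: after a step to the left the entry to the right is smaller than the
    one below, and likewise after a step up. *)
Lemma jdt_slide_reverse T i j : wf T -> uniq (flatten T) ->
  small_hole_ok (entry T) i j ->
  exists S a b, [/\ is_tableau S, shape_of S = shape_of T,
    perm_eq (flatten S) (flatten T), entry S a b = entry T i j &
    exists2 d, d <= i + j & forall n, jdt_slide (n + d) S a b = jdt_slide n T i j].
Proof.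
have [m] := ubnP (i + j); elim: m T i j => // m IH T i j ijm wT uT sT.
have [hT xr xb] := sT; have [fx [r1 r2 r3] [c1 c2 c3]] := hT.
pose goal := exists S a b, [/\ is_tableau S, shape_of S = shape_of T,
    perm_eq (flatten S) (flatten T), entry S a b = entry T i j &
    exists2 d, d <= i + j & forall n, jdt_slide (n + d) S a b = jdt_slide n T i j].
have move i' j' : (i, j) != (i', j') -> entry T i' j' != 0 ->
    small_hole_ok (swap (entry T) i j i' j') i' j' -> (i' + j').+1 = i + j ->
    (forall n, jdt_slide n.+1 (exchange T i j i' j') i' j' =
       jdt_slide n (exchange (exchange T i j i' j') i' j' i j) i j) -> goal.
  move=> nij fx' h' e step.
  have pT := perm_exchange fx fx' nij.
  have := IH (exchange T i j i' j') i' j'; rewrite wf_exchange // (perm_uniq pT).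
  rewrite e -ltnS => /(_ ijm wT uT (small_hole_exchange h')).
  case=> S [a [b [tS shS pS eS [d dij jS]]]]; exists S, a, b; split=> //.
  - by rewrite shS shape_exchange.
  - exact: perm_trans pS pT.
  - by rewrite eS entry_exchange swapR.
  exists d.+1; first by rewrite -e.
  by move=> n; rewrite addnS -addSn jS step exchangeK.
have left j' : j = j'.+1 -> entry T i j'.+1 < entry T i j' ->
    (forall a, i = a.+1 -> entry T a j'.+1 < entry T i j') -> goal.
  move=> ej lt ul; subst j; have nz : entry T i j' != 0 by rewrite -lt0n; lia.
  apply: (move i j') => //; [pair_neq | exact: small_hole_left | by rewrite addnS|].
  move=> n; rewrite jdt_slideS !entry_exchange swapL; last by pair_neq.
  rewrite swapD; [|pair_neq|pair_neq].
  rewrite (negPf nz) andbF /=; case: eqVneq => //= nz'.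
  rewrite ltnNge ltnW //; apply: (c2 j') => //; pair_neq.
have up i' : i = i'.+1 -> entry T i'.+1 j < entry T i' j ->
    (forall b, j = b.+1 -> entry T i'.+1 b < entry T i' j) -> goal.
  move=> ei lt ul; subst i; have nz : entry T i' j != 0 by rewrite -lt0n; lia.
  apply: (move i' j) => //; [pair_neq | exact: small_hole_up |].
  move=> n; rewrite jdt_slideS !entry_exchange swapL; last by pair_neq.
  rewrite swapD; [|pair_neq|pair_neq].
  rewrite (negPf nz) /=; case: eqVneq => //= nz'.
  by rewrite r2 //; pair_neq.
have settled : (forall b, j = b.+1 -> entry T i b < entry T i j) ->
  (forall a, i = a.+1 -> entry T a j < entry T i j) -> goal.
  move=> hl hu; have [] := small_hole_done sT hl hu.
  by exists T, i, j; split=> //; exists 0 => // n; rewrite addn0.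
have ne a b : (i, j) != (a, b) -> entry T i j != entry T a b.
  by move=> n; apply: contra n => /eqP e; apply/eqP/(entry_inj uT).
rewrite /goal in left up settled.
move: left up settled ne; case: (i) (j) => [|i'] [|j'] left up settled ne.
- by apply: settled.
- have [|h] := ltnP (entry T 0 j'.+1) (entry T 0 j'); first by move/left; apply.
  apply: settled => // b [<-]; rewrite ltn_neqAle h eq_sym ne //; pair_neq.
- have [|h] := ltnP (entry T i'.+1 0) (entry T i' 0); first by move/up; apply.
  apply: settled => // b [<-]; rewrite ltn_neqAle h eq_sym ne //; pair_neq.
have [ll|hl] := ltnP (entry T i'.+1 j'.+1) (entry T i'.+1 j'); last first.
  have [uu|hu] := ltnP (entry T i'.+1 j'.+1) (entry T i' j'.+1); last first.
    apply: settled => // b [<-]; rewrite ltn_neqAle ?hl ?hu eq_sym ne //; pair_neq.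
  by apply: (up i') => // b [<-]; apply: leq_ltn_trans hl uu.
have [lu|ul|e] := ltngtP (entry T i'.+1 j') (entry T i' j'.+1).
- by apply: up => // [|b [<-]//]; apply: ltn_trans lu.
- by apply: left => // a [<-].
have nz : entry T i'.+1 j' != 0 by rewrite -lt0n; lia.
by case: (entry_inj uT nz e); lia.
Qed.

(** Place x in the new box and slide it backwards. *)
Lemma jdt_reverse x L' r l : is_tableau L' -> uniq (x :: flatten L') -> 0 < x ->
  is_part l -> l = incr_nth (shape_of L') r ->
  exists L, [/\ is_tableau L, shape_of L = l,
    perm_eq (flatten L) (x :: flatten L') &
    forall N, size (flatten L) <= N -> jdt_slide N L (pos_row x L) (pos_col x L) = L'].
Proof.
move=> tL'; rewrite cons_uniq => /andP[xL' uL'] x0 pl el.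
have wL' : wf L' by case: tL'.
have pL' := shape_part tL'.
pose R := nth [::] L' r; pose j := size R.
pose T := set_nth [::] L' r (rcons R x).
have ad : addable (shape_of L') r by rewrite -part_incr // -el.
have rL' : r <= size L' by rewrite -(size_map size) -[map _ _]/(shape_of L') addable_le.
have eT a b : entry T a b = if (a, b) == (r, j) then x else entry L' a b.
  rewrite /entry nth_set_nth /= xpair_eqE; case: (eqVneq a r) => [->|//] /=.
  rewrite nth_rcons -/R -/j; case: (ltngtP b j) => // h.
  by rewrite [RHS]nth_default // ltnW.
have shT : shape_of T = l.
  rewrite el; apply: (@eq_from_nth _ 0) => [|a _].
    rewrite size_incr_nth !size_map size_set_nth.
    by case: ltnP => h; [apply/maxn_idPr | apply/maxn_idPl; exact: leqW].
  rewrite nth_incr_nth !nth_shape nth_set_nth /= eq_sym; case: eqP => // <-.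
  by rewrite size_rcons.
have pT : perm_eq (flatten T) (x :: flatten L').
  apply/seq.permP=> a; rewrite /T; have [rL|Lr] := ltnP r (size L').
    have cR : count a (rcons R x) = count a R + a x by rewrite -cats1 count_cat /= addn0.
    have := count_flatten_set_nth a (rcons R x) rL; rewrite cR -/R.
    by rewrite addnCA [LHS]addnC => /addnI ->; rewrite addnC.
  have rE : r = size L' by apply/eqP; rewrite eqn_leq rL'.
  rewrite /R nth_default // rE set_nth_size /= flatten_rcons count_cat /=.
  by rewrite addn0 addnC.
have uT : uniq (flatten T) by rewrite (perm_uniq pT) /= xL'.
have wT : wf T.
  rewrite /wf (perm_mem pT) inE negb_or eq_sym -lt0n x0; case/andP: (wL') => _ -> /=.
  rewrite andbT; apply/negP=> /(map_f size); rewrite -[map _ _]/(shape_of T) shT.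
  by case/is_partP: pl => /negP.
have ner : entry T r j != 0 by rewrite eT eqxx -lt0n.
have e0r b : j <= b -> entry L' r b = 0 by move=> jb; apply: nth_default.
have [_ rT cT] := tL'.
have er : entry T r j.+1 = 0 by rewrite eT ifN ?e0r //; pair_neq.
have eb : entry T r.+1 j = 0.
  by rewrite eT ifN; [apply/eqP; apply: contraT => /cT; rewrite e0r | pair_neq].
have lowT : is_part (shape_of T) by rewrite shT.
have sT : small_hole_ok (entry T) r j.
  split; rewrite ?er ?eb //; split=> //.
  - split=> [a b|a b n1 n2|b jb]; last by rewrite er.
    + by rewrite !entry_neq0 //; apply: ltnW.
    + by rewrite !eT (negPf n1) (negPf n2); apply: rT.
  - split=> [b a|b a n1 n2|a ra]; last by rewrite eb.
    + rewrite !entry_neq0 // -!nth_shape => h; apply: leq_trans h _.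
      by case/is_partP: lowT.
    + have n1' : (a, b) != (r, j) by move: n1; rewrite !xpair_eqE andbC.
      have n2' : (a.+1, b) != (r, j) by move: n2; rewrite !xpair_eqE andbC.
      by rewrite !eT (negPf n1') (negPf n2') => /cT/andP[].
have [S [a [b [tS shS pS eS [d dij jS]]]]] := jdt_slide_reverse wT uT sT.
have pSx := perm_trans pS pT; exists S; split=> //; first by rewrite shS.
have uS : uniq (flatten S) by rewrite (perm_uniq pS).
have [-> ->] : (pos_row x S, pos_col x S) = (a, b).
  by apply: pos_entry; rewrite // eS // eT eqxx.
move=> N; rewrite (perm_size pS) => sN.
have dN : d < N by apply: leq_ltn_trans dij (leq_trans _ sN); apply: cell_bound.
rewrite -(subnK (ltnW dN)) jS -(prednK (n := N - d)) ?subn_gt0 // jdt_slideS.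
rewrite er eb eqxx /= /remove_corner.
have -> : take j (nth [::] T r) = R.
  by rewrite nth_set_nth /= eqxx -cats1 take_size_cat.
rewrite set_set_nth eqxx -/T; apply/(@etrans _ _ (drop_empty L')); last first.
  apply/all_filterP/allP=> Q QL; case/andP: wL' => + _.
  by apply: contraNneq => <-.
have [rL|Lr] := ltnP r (size L').
  congr drop_empty; apply: (@eq_from_nth _ [::]) => [|c _].
    by rewrite size_set_nth (maxn_idPr rL).
  by rewrite nth_set_nth /=; case: eqP => [->|].
have rE : r = size L' by apply/eqP; rewrite eqn_leq rL'.
by rewrite /R nth_default // rE set_nth_size /drop_empty filter_rcons.
Qed.

(** * Limiting vacillating tableaux are walks *)

Lemma mem_walksS k l l1 l2 w : l1 \in l :: down l -> l2 \in up l1 ->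
  w \in walks k l2 -> l :: l1 :: w \in walks k.+1 l.
Proof.
move=> h1 h2 hw; rewrite walksS.
apply: (@allpairs_f_dep _ _ _ (fun l1 w => l :: l1 :: w)) => //.
by apply/allpairsPdep; exists l2, w.
Qed.

(** A row of more than n boxes thus has an entry larger than n, which every x <= n
    bumps if it is inserted. *)
Lemma sorted_nth_ge R i : 0 \notin R -> sorted ltn R -> i < size R -> i < nth 0 R i.
Proof.
move=> R0 sR; elim: i => [|i IH] iR.
  by rewrite lt0n; apply: contra R0 => /eqP<-; apply: mem_nth.
by apply: leq_ltn_trans (IH (ltnW iR)) _; apply: sorted_nth_lt.
Qed.

(** The rows below the first gain at most one box per step, so the bound on m keeps
    more than n boxes in the first row, and each insertion bumps an entry out of it.
    Below the first row, therefore, every insertion adds a box, while a deletion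
    removes a corner either there or in the first row. *)
Lemma vacillate_walk s T m n : is_tableau T -> perm_eq (flatten T) (iota 1 m) ->
  all (fun x => 0 < x <= n) s -> n + size s + sumn (behead (shape_of T)) < m ->
  star (vacillate T s) \in walks (size s) (behead (shape_of T)).
Proof.
elim: s T => [|x s IH] T tT pT; first by rewrite inE.
case/andP=> /andP[x0 xn] hs hm.
have uT : uniq (flatten T) by rewrite (perm_uniq pT) iota_uniq.
have sz : sumn (shape_of T) = m by rewrite sumn_shape (perm_size pT) size_iota.
have xT : x \in flatten T.
  rewrite (perm_mem pT) mem_iota x0 add1n ltnS; apply: leq_trans xn _.
  by apply: ltnW; apply: leq_trans hm; rewrite -addnA ltnS leq_addr.
have [tT' pT' [r shT]] := jdt_delete_spec tT uT xT.
rewrite [vacillate _ _]/=; set T' := jdt_delete x T in tT' pT' shT *.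
have uT' : uniq (x :: flatten T') by rewrite -(perm_uniq pT').
have [ts ps [r2 sh2]] := rsk_insert_spec tT' x0 uT'.
have ps' : perm_eq (flatten (rsk_insert x T')) (iota 1 m).
  by rewrite (permPl ps) -(permPl pT').
have head_size : n < size (nth [::] T' 0).
  have : n.+1 < nth 0 (shape_of T) 0.
    have e : sumn (shape_of T) = nth 0 (shape_of T) 0 + sumn (behead (shape_of T)).
      by case: (shape_of T).
    by move: hm; rewrite /= -sz e; lia.
  by rewrite shT nth_incr_nth nth_shape; case: (r == 0) => /=; lia.
case eT' : T' head_size tT' pT' shT uT' ts ps sh2 ps' => [//|R L] /= nR.
move=> tRL pRL shT uRL ts ps sh2 ps'.
have /is_tableau_cons[/and3P[Rn R0 wL] riR roR tL] := tRL.
have sR := row_sorted R0 riR.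
have xR : slot x R < size R.
  rewrite /slot -has_find; apply/hasP; exists (nth 0 R n); first exact: mem_nth.
  by apply: leq_ltn_trans xn _; apply: sorted_nth_ge.
set y := nth 0 R (slot x R).
have ery : rsk_insert x (R :: L) = set_nth 0 R (slot x R) x :: rsk_insert y L.
  by rewrite rsk_insert_cons xR.
have y0 : 0 < y by apply: leq_ltn_trans (nth_slot xR).
have uy : uniq (y :: flatten L).
  move: uRL => /andP[_]; rewrite cat_uniq cons_uniq => /and3P[uR /hasPn RL ->].
  by rewrite andbT; apply/negP=> /RL; rewrite mem_nth.
have [ty py [r3 sh3]] := rsk_insert_spec tL y0 uy.
have pl1 : is_part (shape_of L) by apply: shape_part.
have memd : shape_of L \in behead (shape_of T) :: down (behead (shape_of T)).
  have pl : is_part (behead (shape_of T)) by apply/part_behead/shape_part.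
  rewrite inE; move: pl; rewrite shT /=; case: (r) => [|r'] /= pl; first by rewrite eqxx.
  by rewrite mem_down ?orbT.
apply: mem_walksS memd _ _.
  by rewrite -/(shape_of L); apply: (@mem_up _ r3) => //; rewrite -sh3; apply: shape_part.
rewrite -[X in vacillate X]/(rsk_insert x (R :: L)) -sh3.
have := IH (rsk_insert x (R :: L)) ts ps' hs.
rewrite ery; apply; rewrite /= -/(shape_of _) sh3 sumn_incr.
have : sumn (shape_of L) <= sumn (behead (shape_of T)).
  by rewrite shT; case: (r) => [|r'] //=; rewrite sumn_incr.
by move=> h; apply: leq_ltn_trans hm; rewrite /= !addnS addSn ltnS leq_add2l.
Qed.

(** * Every walk is a limiting vacillating tableau *)

(** Rows filled with consecutive numbers: some tableau of the final shape is needed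
    to start the backward construction. *)
Fixpoint fill b (l : seq nat) : tableau :=
  if l is a :: l' then iota b a :: fill (b + a) l' else [::].

Lemma flatten_fill b l : flatten (fill b l) = iota b (sumn l).
Proof. by elim: l b => //= a l IH b; rewrite IH iotaD. Qed.

Lemma shape_fill b l : shape_of (fill b l) = l.
Proof. by elim: l b => //= a l IH b; rewrite size_iota IH. Qed.

Lemma fill_tableau b l : 0 < b -> is_part l -> is_tableau (fill b l).
Proof.
elim: l b => [|a l IH] b b0 pl; first exact: is_tableau_nil.
have a0 : 0 < a by case/andP: pl; rewrite inE negb_or eq_sym lt0n => /andP[].
have tl := IH (b + a) (ltn_addr _ b0) (part_behead pl).
have nil_iota c d j : nth 0 (iota c d) j != 0 -> j < d.
  by rewrite ltnNge; apply: contra => h; rewrite nth_default ?size_iota.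
apply/is_tableau_cons; split=> //.
- apply/and3P; split; [by case: (a) a0 | | by case: tl].
  by rewrite mem_iota; lia.
- by move=> j /nil_iota ja; rewrite !nth_iota //; lia.
- case: l pl {tl IH} => [|c l] pl j /=; first by rewrite nth_nil.
  move/nil_iota => jc; have ca : c <= a by case/is_partP: pl => _ /(_ 0).
  by rewrite !nth_iota //; lia.
Qed.
Lemma set_nth_cat (T : Type) (x0 : T) s1 a s2 b :
  set_nth x0 (s1 ++ a :: s2) (size s1) b = s1 ++ b :: s2.
Proof. by elim: s1 => //= c s1 ->. Qed.

Lemma nth_size_cat (T : Type) (x0 : T) s1 a s2 : nth x0 (s1 ++ a :: s2) (size s1) = a.
Proof. by rewrite nth_cat ltnn subnn. Qed.

(** Where nothing lies below, an entry of the first row slides to the end of it. *)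
Lemma jdt_slide_row0 n R1 x R2 L : 0 \notin R2 -> size (nth [::] L 0) <= size R1 ->
  size R2 < n -> R1 ++ R2 != [::] -> [::] \notin L ->
  jdt_slide n ((R1 ++ x :: R2) :: L) 0 (size R1) = (R1 ++ R2) :: L.
Proof.
elim: n R1 R2 => // n IH R1 R2 R20 sL sn Rn Ln; rewrite jdt_slideS.
have -> : entry ((R1 ++ x :: R2) :: L) 1 (size R1) = 0 by rewrite /entry /= nth_default.
have -> : entry ((R1 ++ x :: R2) :: L) 0 (size R1).+1 = nth 0 R2 0.
  by rewrite /entry /= nth_cat ltnNge leqnSn /= subSn // subnn.
case: R2 R20 sn Rn => [|z R2] R20 sn Rn /=.
  rewrite /remove_corner /= cats0 take_size_cat //; rewrite cats0 in Rn.
  rewrite Rn; congr (_ :: _); apply/all_filterP/allP=> Q QL.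
  by apply: contraNneq Ln => <-.
have z0 : z != 0 by move: R20; rewrite inE negb_or eq_sym => /andP[].
rewrite (negPf z0) /=.
have -> : exchange ((R1 ++ x :: z :: R2) :: L) 0 (size R1) 0 (size R1).+1 =
          (rcons R1 z ++ x :: R2) :: L.
  rewrite /exchange.
  have -> : entry ((R1 ++ x :: z :: R2) :: L) 0 (size R1) = x by apply: nth_size_cat.
  have -> : entry ((R1 ++ x :: z :: R2) :: L) 0 (size R1).+1 = z.
    by rewrite /entry /= -cat_rcons -(size_rcons R1 x) nth_size_cat.
  by rewrite /set_entry /= set_nth_cat -cat_rcons -(size_rcons R1 z) set_nth_cat.
rewrite -cat_rcons in Rn *.
rewrite -(size_rcons R1 z) IH //.
- by move: R20; rewrite inE negb_or => /andP[].
- by rewrite size_rcons leqW.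
Qed.

(** A slide that starts below the first row never sees it. *)
Lemma jdt_slide_below n R L i j : R != [::] ->
  jdt_slide n (R :: L) i.+1 j = R :: jdt_slide n L i j.
Proof.
move=> Rn; elim: n L i j => // n IH L i j; rewrite !jdt_slideS /entry /=.
case: ifP => _; first by rewrite /remove_corner /= Rn.
by case: ifP => _; rewrite -IH.
Qed.

(** The entries of the whole tableau are 1, ..., m, so the lower rows determine the
    first one. *)
Definition top_row m (L : tableau) := [seq v <- iota 1 m | v \notin flatten L].

Lemma iota_split a n y : a <= y < a + n ->
  iota a n = iota a (y - a) ++ y :: iota y.+1 (a + n - y.+1).
Proof.
case/andP=> ay ya; have e : n = (y - a) + (1 + (a + n - y.+1)) by lia.
by rewrite [in LHS]e !iotaD /= subnKC // addn1.
Qed.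

Lemma rsk_insert_top A y B x L : (forall v, v \in A -> v < x) -> x < y ->
  rsk_insert x ((A ++ y :: B) :: L) = (A ++ x :: B) :: rsk_insert y L.
Proof.
move=> Ax xy; have sl : slot x (A ++ y :: B) = size A.
  rewrite /slot find_cat (_ : has _ A = false) /= ?xy ?addn0 //.
  by apply/hasPn => v /Ax; rewrite -leqNgt; apply: ltnW.
rewrite rsk_insert_cons sl size_cat /= addnS ltnS leq_addr.
by rewrite nth_size_cat set_nth_cat.
Qed.

(** If the values between x and y all lie below the first row, then y is the entry
    bumped by x. *)
Lemma top_row_insert m x y L S : 0 < x -> x < y -> y <= m ->
  x \notin flatten L -> y \notin flatten L ->
  (forall z, x < z < y -> z \in flatten L) ->
  perm_eq (flatten S) (y :: flatten L) ->
  rsk_insert x ([seq v <- iota 1 m | v \notin x :: flatten L] :: L) =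
  top_row m S :: rsk_insert y L.
Proof.
move=> x0 xy ym xL yL mid pS.
pose A := [seq v <- iota 1 (x - 1) | v \notin flatten L].
pose B := [seq v <- iota y.+1 (1 + m - y.+1) | v \notin flatten L].
have eio : iota 1 m =
    iota 1 (x - 1) ++ x :: iota x.+1 (y - x.+1) ++ y :: iota y.+1 (1 + m - y.+1).
  rewrite (@iota_split 1 m x); last by lia.
  congr (_ ++ _ :: _); rewrite (@iota_split _ _ y); last by lia.
  by congr (_ ++ _ :: iota _ _); lia.
have fmid (P : pred nat) : (forall z, P z -> z \notin flatten L) ->
    [seq v <- iota x.+1 (y - x.+1) | P v] = [::].
  move=> hP; apply/eqP; rewrite -[_ == _]negbK -has_filter.
  apply/hasPn=> z; rewrite mem_iota => hz; apply/negP=> /hP; rewrite mid //; lia.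
have -> : [seq v <- iota 1 m | v \notin x :: flatten L] = A ++ y :: B.
  rewrite eio filter_cat /= mem_head /= filter_cat fmid /=; last first.
    by move=> z; rewrite inE negb_or => /andP[].
  rewrite inE negb_or yL (gtn_eqF xy) /=; congr (_ ++ _ :: _); apply: eq_in_filter => z.
    by rewrite mem_iota inE negb_or => hz; rewrite (_ : z != x) //; lia.
  by rewrite mem_iota inE negb_or => hz; rewrite (_ : z != x) //; lia.
rewrite rsk_insert_top // => [|v]; last by rewrite mem_filter mem_iota; lia.
congr (_ :: _); rewrite /top_row (eq_filter (a2 := fun v => v \notin y :: flatten L)).
  rewrite eio filter_cat /= inE negb_or xL (ltn_eqF xy) /= filter_cat fmid /=; last first.
    by move=> z; rewrite inE negb_or => /andP[].
  rewrite mem_head /=; congr (_ ++ _ :: _); apply: eq_in_filter => z.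
    by rewrite mem_iota inE negb_or => hz; rewrite (_ : z != y) //; lia.
  by rewrite mem_iota inE negb_or => hz; rewrite (_ : z != y) //; lia.
by move=> v; rewrite (perm_mem pS).
Qed.

(** The first row begins with 1, ..., B, because the entries below it exceed B. An
    entry x > B thus stands to the right of all lower columns. *)
Lemma jdt_delete_top m x L B : is_tableau L -> x \notin flatten L -> x <= m ->
  B < x -> 0 < B -> all (fun v => B < v) (flatten L) -> size (flatten L) <= B ->
  jdt_delete x (top_row m L :: L) =
  [seq v <- iota 1 m | v \notin x :: flatten L] :: L.
Proof.
move=> tL xL xm Bx B0 LB sL.
pose R1 := [seq v <- iota 1 (x - 1) | v \notin flatten L].
pose R2 := [seq v <- iota x.+1 (1 + m - x.+1) | v \notin flatten L].
have eio : iota 1 m = iota 1 (x - 1) ++ x :: iota x.+1 (1 + m - x.+1).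
  by apply: iota_split; lia.
have eR : top_row m L = R1 ++ x :: R2 by rewrite /top_row eio filter_cat /= xL.
have xR1 : x \notin R1 by rewrite mem_filter mem_iota; lia.
have sR1 : B <= size R1.
  have -> : B = size [seq v <- iota 1 B | v \notin flatten L].
    rewrite (all_filterP _) ?size_iota //; apply/allP=> z; rewrite mem_iota => hz.
    by apply/negP=> /(allP LB); lia.
  rewrite /R1 (_ : x - 1 = B + (x - 1 - B)); last by lia.
  by rewrite iotaD filter_cat size_cat leq_addr.
rewrite jdt_deleteE.
have -> : pos_row x (top_row m L :: L) = 0.
  by rewrite /pos_row /= eR mem_cat mem_head orbT.
have -> : pos_col x (top_row m L :: L) = size R1.
  rewrite /pos_col /pos_row /= eR mem_cat mem_head orbT /= index_cat (negPf xR1) /= eqxx addn0 //.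
have wL : wf L by case: tL.
rewrite eR jdt_slide_row0 //.
- congr (_ :: _); rewrite eio filter_cat /= mem_head /=; congr (_ ++ _); apply: eq_in_filter => z.
    by rewrite mem_iota inE negb_or => hz; rewrite (_ : z != x) //; lia.
  by rewrite mem_iota inE negb_or => hz; rewrite (_ : z != x) //; lia.
- by rewrite mem_filter mem_iota; lia.
- apply: leq_trans sR1; apply: leq_trans sL; case: (L) => [//|Q L'] /=.
  by rewrite size_cat leq_addr.
- by rewrite /= !size_cat /=; lia.
- by rewrite -size_eq0 size_cat; lia.
- by case/andP: wL.
Qed.
Lemma jdt_delete_below R x L : R != [::] -> x \notin R ->
  jdt_delete x (R :: L) =
  R :: jdt_slide (size (flatten (R :: L))) L (pos_row x L) (pos_col x L).
Proof.
by move=> Rn xR; rewrite jdt_deleteE /pos_col /pos_row /= (negPf xR) jdt_slide_below.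
Qed.

(** The largest value below y that is missing in s; at most size s values are skipped. *)
Lemma gap_below B y (s : seq nat) : uniq s -> B + size s + 1 < y ->
  exists x, [/\ B < x, x < y, y <= x + size s + 1, x \notin s
              & forall z, x < z < y -> z \in s].
Proof.
move=> us hy; pose P v := (v < y) && (v \notin s).
have [v vi vs] : exists2 v, v \in iota B.+1 (size s).+1 & v \notin s.
  apply/allPn/negP=> /allP h.
  have := uniq_leq_size (iota_uniq B.+1 (size s).+1) h.
  by rewrite size_iota ltnn.
have vy : v < y by move: vi; rewrite mem_iota; lia.
have exP : exists v, P v by exists v; rewrite /P vy.
have ubP z : P z -> z <= y by case/andP=> /ltnW.
case: (ex_maxnP exP ubP) => x /andP[xy xs] max_x.
have vx : v <= x by apply: max_x; rewrite /P vy.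
have mid z : x < z < y -> z \in s.
  case/andP=> xz zy; apply: contraLR xz => zs.
  by rewrite -leqNgt max_x // /P zy.
exists x; split=> //.
  by move: vi; rewrite mem_iota; lia.
have : {subset iota x.+1 (y - x.+1) <= s}.
  by move=> z; rewrite mem_iota => hz; apply: mid; lia.
by move/(uniq_leq_size (iota_uniq _ _)); rewrite size_iota leq_subLR addSn addn1.
Qed.

(** The walk is read backwards. Undoing the last insertion below the first row gives
    the entry y that was bumped out of the first row, and the inserted x has to be
    the largest value below y that the lower rows miss. If the shape changed at the
    half-step, x came from the lower rows, and a backward slide puts it back there;
    otherwise x came from the first row. All numbers stay above B, which is at least
    the number of lower columns, so that the start of the first row is never used and
    the result does not depend on m. *)
Lemma walk_realized k l w B : is_part l -> w \in walks k l -> sumn l + k < B ->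
  exists L s, [/\ is_tableau L, shape_of L = l, uniq (flatten L)
    & [/\ all (fun v => B < v) (flatten L), all (fun v => B < v) s, size s = k
    & forall m n, all (fun x => x <= n) s -> all (fun x => x <= m) (flatten L) ->
      n + size (flatten L) + k < m -> star (vacillate (top_row m L :: L) s) = w]].
Proof.
elim: k l w B => [|k IH] l w B pl.
  rewrite inE => /eqP-> lB; exists (fill B.+1 l), [::].
  rewrite flatten_fill shape_fill iota_uniq; split=> //; first exact: fill_tableau; split=> //.
    by apply/allP=> v; rewrite mem_iota => /andP[].
  by move=> m n _ _ _; rewrite /= -/(shape_of (fill B.+1 l)) shape_fill.
rewrite walksS => /allpairsPdep[l1 [w1 [l1l w1k ->{w}]]] lB.
move: w1k => /allpairsPdep[l2 [w' [l2l w'k ->{w1}]]].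
have [pl1 l1s] : is_part l1 /\ sumn l1 <= sumn l.
  move: l1l; rewrite inE => /predU1P[->//|/(downP pl)[pl1 [r ->]]].
  by rewrite sumn_incr.
have [pl2 [r el2]] := upP pl1 l2l.
(* The step below goes down from y to x by at most sumn l1 + 1. *)
pose B' := B + sumn l1 + 1.
have B'B v : B' < v -> B < v by apply: leq_ltn_trans; rewrite /B' -addnA leq_addr.
have B0 : 0 < B by apply: leq_ltn_trans lB.
have l1B : sumn l1 < B.
  by apply: leq_ltn_trans lB; apply: leq_trans l1s (leq_addr _ _).
have l2B : sumn l2 + k < B'.
  by rewrite el2 sumn_incr /B'; move: lB; clear; lia.
have [S [s [tS shS uS [SB sB ss run]]]] := IH l2 w' B' pl2 w'k l2B.
have [|y [L1 [tL1 shL1 y0 pS eS]]] := rsk_reverse tS uS pl1 (r := r).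
  by rewrite shS.
have szL1 : size (flatten L1) = sumn l1 by rewrite -sumn_shape shL1.
have uyL : uniq (y :: flatten L1) by rewrite -(perm_uniq pS).
have [yL1 uL1] := andP uyL.
have /andP[yB LB'] : (B' < y) && all (fun v => B' < v) (flatten L1).
  by rewrite -[_ && _]/(all _ (y :: _)) -(perm_all _ pS).
have LB : all (fun v => B < v) (flatten L1).
  exact: sub_all LB'.
have [|x [Bx xy yx xL1 mid]] := gap_below (B := B) uL1 (y := y).
  by rewrite szL1.
have x0 : 0 < x by apply: ltn_trans Bx.
have [L [tL shL uL LgB [szL subL del]]] : exists L, [/\ is_tableau L, shape_of L = l,
    uniq (flatten L), all (fun v => B < v) (flatten L)
  & [/\ size (flatten L1) <= size (flatten L),
      {subset flatten L1 <= flatten L}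
    & forall m, x <= m -> jdt_delete x (top_row m L :: L) =
        [seq v <- iota 1 m | v \notin x :: flatten L1] :: L1]].
  move: l1l; rewrite inE => /predU1P[e|/(downP pl)[_ [r' el]]].
    exists L1; rewrite shL1 e; split=> //; split=> // m xm.
    by apply: (@jdt_delete_top _ _ _ B) => //; rewrite szL1 ltnW.
  have uxL : uniq (x :: flatten L1) by rewrite /= xL1.
  have [|L [tL shL pL jL]] := jdt_reverse tL1 uxL x0 pl (r := r').
    by rewrite shL1.
  exists L; split=> //.
  - by rewrite (perm_uniq pL).
  - by rewrite (perm_all _ pL) /= Bx.
  split=> [|v vL|m xm].
  - by rewrite (perm_size pL) /=.
  - by rewrite (perm_mem pL) inE vL orbT.
  have top0 : top_row m L != [::].
    rewrite -size_eq0 -lt0n size_filter -has_count; apply/hasP; exists 1.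
      by rewrite mem_iota /= add1n ltnS (leq_trans x0).
    rewrite (perm_mem pL) inE negb_or (ltn_eqF (leq_ltn_trans B0 Bx)) /=.
    by apply/negP=> /(allP LB); rewrite ltnNge B0.
  rewrite jdt_delete_below //; last first.
    by rewrite mem_filter (perm_mem pL) mem_head.
  rewrite jL ?size_cat ?leq_addl //; congr (_ :: _).
  by apply: eq_filter => v; rewrite (perm_mem pL).
exists L, (x :: s); rewrite /= Bx ss; split=> //; split=> //.
  exact: sub_all sB.
move=> m n /andP[xn sn] Lm hm.
have xm : x <= m.
  by apply: leq_trans xn _; apply: ltnW; apply: leq_ltn_trans hm; rewrite -addnA leq_addr.
have ym : y <= m.
  by apply: leq_trans yx _; move: szL xn hm; clear; lia.
rewrite [vacillate _ _]/= del // (top_row_insert x0 xy ym xL1 yL1 mid pS) eS.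
rewrite /= -/(shape_of L) -/(shape_of L1) -/(star _) shL shL1.
congr [:: _, _ & _]; apply: (run m n) => //.
  rewrite (perm_all _ pS) /= ym; apply/allP=> v /subL; exact: (allP Lm).
by rewrite (perm_size pS) /=; move: szL hm; clear; lia.
Qed.

Lemma star_vacillating_walk k (s : seq nat) n m : size s = k ->
  in_range n s -> n + k < m ->
  star (vacillating_tableau m s) \in walks k [::].
Proof.
move=> <- sn nm; have m0 : 0 < m by lia.
have e : drop_empty [:: iota 1 m] = [:: iota 1 m].
  by rewrite /drop_empty /= -size_eq0 size_iota -lt0n m0.
have t : is_tableau [:: iota 1 m].
  have := @fill_tableau 1 [:: m] isT; apply.
  by rewrite /is_part inE eq_sym -lt0n m0.
rewrite /vacillating_tableau e; apply: (vacillate_walk (m := m) (n := n) t) => //.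
  by rewrite /= cats0.
by rewrite /= addn0.
Qed.

Lemma walk_limiting k w : w \in walks k [::] ->
  exists s : seq nat, [/\ size s = k, all (fun x => 0 < x) s
    & forall n m, in_range n s -> n + k < m -> star (vacillating_tableau m s) = w].
Proof.
move=> wk; have k1 : sumn [::] + k < k.+1 by [].
have [L [s [_ shL _ [_ sB ss run]]]] := walk_realized (l := [::]) isT wk k1.
have {shL} L0 : L = [::] by case: L shL {run}.
exists s; split=> //; first by apply: sub_all sB => v; lia.
move=> n m sn nm; rewrite L0 in run; rewrite -(run m n) //.
- have -> : top_row m [::] = iota 1 m by apply/all_filterP/allP.
  by rewrite /vacillating_tableau /drop_empty /= -size_eq0 size_iota -lt0n (leq_ltn_trans _ nm).
- by apply: sub_all sn => v /andP[].
- by rewrite addn0.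
Qed.

(** * The exponential generating function as a formal power series *)

Section FormalPowerSeries.
Import GRing.Theory.
Local Open Scope ring_scope.
Lemma fps_powS (f : fps) j n :
  fps_pow f j.+1 n = \sum_(i < n.+1) f i * fps_pow f j (n - i)%N.
Proof. by []. Qed.

(** Coefficients below N are those of a truncated polynomial, which gives access to
    the formal derivative of powers. *)
Lemma coef_fps_pow (f : fps) N j n : (n < N)%N ->
  fps_pow f j n = ((\poly_(i < N) f i) ^+ j)`_n.
Proof.
elim: j n => [|j IH] n nN; first by rewrite expr0 coef1.
rewrite exprS coefM fps_powS; apply: eq_bigr => i _.
have iN : (i < N)%N by apply: leq_ltn_trans nN; rewrite -ltnS.
by rewrite coef_poly iN -IH // (leq_ltn_trans (leq_subr _ _)).
Qed.

Lemma fps_pow_small (f : fps) j n : f 0%N = 0 -> (n < j)%N -> fps_pow f j n = 0.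
Proof.
move=> f0; elim: j n => // j IH n nj; rewrite fps_powS; apply: big1 => -[[|i] hi] _ /=.
  by rewrite f0 mul0r.
by rewrite IH ?mulr0 //; lia.
Qed.

Lemma fps_exp_trunc (f : fps) N n : f 0%N = 0 -> (n <= N)%N ->
  fps_exp f n = \sum_(j < N.+1) fps_pow f j n / (j`!)%:R.
Proof.
move=> f0 nN; rewrite /fps_exp (big_ord_widen N.+1 (fun j => fps_pow f j n / (j`!)%:R)) //.
rewrite big_mkcond; apply: eq_bigr => j _; case: ltnP => // nj.
by rewrite fps_pow_small ?mul0r.
Qed.

Lemma fact_neq0 n : (n`!)%:R != 0 :> rat.
Proof. by rewrite Num.Theory.pnatr_eq0 -lt0n fact_gt0. Qed.

(** (exp f)' = f' exp f, coefficient by coefficient. *)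
Lemma fps_exp_deriv (f : fps) n : f 0%N = 0 ->
  fps_exp f n.+1 *+ n.+1 = \sum_(i < n.+1) f i.+1 *+ i.+1 * fps_exp f (n - i)%N.
Proof.
move=> f0; pose P := \poly_(i < n.+2) f i.
have derP j : fps_pow f j.+1 n.+1 *+ n.+1 / (j.+1`!)%:R =
    \sum_(i < n.+1) f i.+1 *+ i.+1 * (fps_pow f j (n - i)%N / (j`!)%:R).
  rewrite (@coef_fps_pow f n.+2) // -coef_deriv -/P deriv_exp coefMn coefM.
  rewrite factS natrM -[_ *+ j.+1]mulr_natr invfM mulrA mulfK; last first.
    by rewrite Num.Theory.pnatr_eq0.
  rewrite mulr_suml; apply: eq_bigr => -[i hi] _ /=.
  rewrite coef_deriv coef_poly ltnS hi (@coef_fps_pow f n.+2) ?mulrA //.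
  by apply: leq_ltn_trans (leq_subr _ _) _; rewrite ltnW.
rewrite (@fps_exp_trunc _ n.+1) // big_ord_recl.
have -> : fps_pow f (@ord0 n.+1) n.+1 = 0 by [].
rewrite mul0r add0r -sumrMnl; under eq_bigr => j _ do
  rewrite lift0 -mulrnAl derP.
rewrite exchange_big /=; apply: eq_bigr => i _.
by rewrite -mulr_sumr (@fps_exp_trunc _ n) // leq_subr.
Qed.

Lemma fps_pow_2X j n : fps_pow fps_2X j n = 2 ^+ j * (n == j)%:R.
Proof.
elim: j n => [|j IH] n; first by rewrite mul1r.
rewrite fps_powS.
case: n => [|n].
  by rewrite big_ord1 /fps_2X /= !mulr0 mul0r.
rewrite big_ord_recl big_ord_recl big1 => [|[i hi] _]; last first.
  by rewrite /fps_2X /= mulr0 mul0r.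
by rewrite /fps_2X /= mulr0 mul0r add0r addr0 IH subSS subn0 eqSS mulr1 exprS mulrA.
Qed.

Lemma fps_exp_2X n : fps_exp fps_2X n = 2 ^+ n / (n`!)%:R.
Proof.
rewrite /fps_exp big_ord_recr /= fps_pow_2X eqxx mulr1 big1 ?add0r // => -[j jn] _ /=.
by rewrite fps_pow_2X gtn_eqF // mulr0 mul0r.
Qed.

(** Both sides satisfy A' = e^(2x) A with A(0) = 1. *)
Lemma egf_of_rec (a : nat -> nat) n : a 0%N = 1%N ->
  (forall n, a n.+1 = \sum_(i < n.+1) 'C(n, i) * 2 ^ i * a (n - i))%N ->
  egf a n = fps_exp (fun i => (fps_exp fps_2X i - fps_one i) / 2) n.
Proof.
move=> a0 arec; pose h i := (fps_exp fps_2X i - fps_one i) / 2; rewrite -/h.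
have h0 : h 0%N = 0 by rewrite /h fps_exp_2X /fps_one /= divr1 subrr mul0r.
have hS i : h i.+1 *+ i.+1 = 2 ^+ i / (i`!)%:R.
  rewrite /h fps_exp_2X /fps_one /= subr0 factS exprS natrM -[_ *+ i.+1]mulr_natr.
  have : (i.+1)%:R != 0 :> rat by rewrite Num.Theory.pnatr_eq0.
  move: (fact_neq0 i); move: (i`!)%:R (i.+1)%:R (2 ^+ i) => u v w u0 v0.
  by field; rewrite u0 v0.
elim/ltn_ind: n => -[_|n IH].
  by rewrite /egf a0 /fps_exp big_ord1.
have nz : (n.+1)%:R != 0 :> rat by rewrite Num.Theory.pnatr_eq0.
apply: (mulIf nz); rewrite !mulr_natr fps_exp_deriv //.
rewrite -mulr_natr /egf factS natrM invfM mulrA mulrAC mulfVK // arec.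
rewrite natr_sum mulr_suml; apply: eq_bigr => -[i hi] _ /=.
rewrite hS -IH /egf; last by rewrite ltnS leq_subr.
rewrite !natrM natrX.
have -> : ('C(n, i))%:R = (n`!)%:R / ((i`!)%:R * ((n - i)`!)%:R) :> rat.
  by rewrite -(@bin_fact n i) // natrM natrM mulfK // mulf_neq0 ?fact_neq0.
move: (fact_neq0 n) (fact_neq0 i) (fact_neq0 (n - i)).
move: (n`!)%:R (i`!)%:R ((n - i)`!)%:R (2 ^+ i) (a (n - i)%N)%:R.
by move=> u v w p q u0 v0 w0; field; rewrite ?u0 ?v0 ?w0.
Qed.
End FormalPowerSeries.

(** * The exponential generating function on the real line *)

Section Dobinski.
Import Order.TTheory GRing.Theory Num.Theory numFieldNormedType.Exports.
Local Open Scope classical_set_scope.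
Local Open Scope ring_scope.
Variable R : realType.
Implicit Types (x y l : R) (u : nat -> R).

Lemma cvg_bigsum (I : Type) (r : seq I) (f : I -> nat -> R) (l : I -> R) :
  (forall i, f i n @[n --> \oo] --> l i) ->
  \sum_(i <- r) f i n @[n --> \oo] --> \sum_(i <- r) l i.
Proof.
move=> fl; elim: r => [|i r IH].
  by rewrite big_nil; under eq_fun do rewrite big_nil; apply: cvg_cst.
rewrite big_cons; under eq_fun do rewrite big_cons.
exact: cvgD.
Qed.

Lemma ler_cvgn u v l l' : u n @[n --> \oo] --> l -> v n @[n --> \oo] --> l' ->
  (forall n, u n <= v n) -> l <= l'.
Proof. by move=> ul vl uv; apply: ler_cvg_to ul vl _; apply: nearW. Qed.

Definition exp_sum n y : R := series (exp_coeff y) n.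

Lemma exp_sumE n y : exp_sum n y = \sum_(0 <= k < n) y ^+ k / k`!%:R.
Proof. by []. Qed.

Lemma cvg_exp_sum y : exp_sum n y @[n --> \oo] --> expR y.
Proof. exact: is_cvg_series_exp_coeff. Qed.

Lemma exp_sum_le n y : 0 <= y -> exp_sum n y <= expR y.
Proof.
move=> y0; apply: nondecreasing_cvgn_le (is_cvg_series_exp_coeff y) n.
by apply: nondecreasing_series => k _ _; apply: exp_coeff_ge0.
Qed.

(** The tails of the exponential series obey the triangle inequality term by term. *)
Lemma exp_tail_le n y : `|expR y - exp_sum n y| <= expR `|y| - exp_sum n `|y|.
Proof.
have h z : exp_sum (k + n) z - exp_sum n z @[k --> \oo] --> expR z - exp_sum n z.
  by apply: cvgB; [rewrite (cvg_shiftn n (exp_sum^~ z)); apply: cvg_exp_sum | apply: cvg_cst].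
have hn : `|exp_sum (k + n) y - exp_sum n y| @[k --> \oo] --> `|expR y - exp_sum n y|.
  exact: cvg_norm (h y).
apply: (ler_cvgn hn (h _)) => k.
have e z : exp_sum (k + n) z - exp_sum n z = \sum_(n <= i < k + n) z ^+ i / i`!%:R.
  rewrite !exp_sumE (@big_cat_nat _ _ _ n) ?leq_addl //=.
  by rewrite addrAC subrr add0r.
rewrite !e; apply: le_trans (ler_norm_sum _ _ _) _; apply: ler_sum => i _.
by rewrite normrM normrX normfV normr_nat.
Qed.

(** Up to the factor e^(-1/2), the probability of m under the Poisson distribution of
    parameter 1/2. *)
Definition poisson_weight m : R := 2^-1 ^+ m / m`!%:R.

Lemma poisson_weight_ge0 m : 0 <= poisson_weight m.
Proof. by rewrite mulr_ge0 ?exprn_ge0 ?invr_ge0 ?ler0n. Qed.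

(** The truncated k-th moment of twice the Poisson variable, with the same factor
    left out. *)
Definition moment k M : R := \sum_(0 <= m < M) poisson_weight m * (m.*2)%:R ^+ k.

Lemma poisson_weightS m : poisson_weight m.+1 * (m.+1.*2)%:R = poisson_weight m.
Proof.
rewrite /poisson_weight exprS factS natrM -muln2 natrM.
have : m.+1%:R != 0 :> R by rewrite pnatr_eq0.
have : m`!%:R != 0 :> R by rewrite pnatr_eq0 -lt0n fact_gt0.
move: (m.+1%:R) (m`!%:R) (2^-1 ^+ m) => p q r p0 q0.
by field; rewrite p0 q0.
Qed.

(** The weight of m + 1 absorbs one factor 2 (m + 1), and the remaining power
    (2 m + 2)^k is expanded by the binomial formula. *)
Lemma momentS k M :
  moment k.+1 M.+1 = \sum_(i < k.+1) ('C(k, i) * 2 ^ i)%:R * moment (k - i) M.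
Proof.
rewrite /moment big_nat_recl // expr0n /= mulr0 add0r.
under eq_bigr => m _ do rewrite exprS mulrA poisson_weightS doubleS -addn2 natrD exprDn mulr_sumr.
rewrite exchange_big /=; apply: eq_bigr => i _; rewrite mulr_sumr.
apply: eq_bigr => m _; rewrite natrM natrX -mulr_natr; ring.
Qed.

Variable a : nat -> nat.
Hypothesis a0 : a 0%N = 1%N.
Hypothesis arec : forall n,
  (a n.+1 = \sum_(i < n.+1) 'C(n, i) * 2 ^ i * a (n - i))%N.

(** A formula of Dobinski type: the moments satisfy the recurrence of a, so they equal
    a up to the factor e^(1/2). *)
Lemma cvg_moment k : moment k M @[M --> \oo] --> (a k)%:R * expR 2^-1.
Proof.
elim/ltn_ind: k => -[_|k IH].
  rewrite a0 mul1r; have := @cvg_exp_sum 2^-1.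
  apply: cvg_trans; apply: near_eq_cvg; apply: nearW => M.
  by rewrite exp_sumE /moment; apply: eq_bigr => m _; rewrite expr0 mulr1.
rewrite -(cvg_shiftS (moment k.+1)) /=; under eq_fun do rewrite momentS.
rewrite arec natr_sum mulr_suml; apply: cvg_bigsum => i.
rewrite [(_ * a _)%:R]natrM -[X in _ --> X]mulrA; apply: cvgM; first exact: cvg_cst.
by apply: IH; rewrite ltnS leq_subr.
Qed.

Definition egf_sum n x : R := \sum_(0 <= k < n) (a k)%:R * (x ^+ k / k`!%:R).

Definition mixed_sum x n M : R := \sum_(0 <= m < M) poisson_weight m * exp_sum n (m.*2%:R * x).
Definition mixed_exp x M : R := \sum_(0 <= m < M) poisson_weight m * expR (m.*2%:R * x).

Lemma cvg_mixed_sum x n :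
  mixed_sum x n M @[M --> \oo] --> egf_sum n x * expR 2^-1.
Proof.
have e M : mixed_sum x n M = \sum_(0 <= k < n) x ^+ k / k`!%:R * moment k M.
  rewrite /mixed_sum; under eq_bigr do rewrite exp_sumE mulr_sumr.
  rewrite exchange_big /=; apply: eq_bigr => k _; rewrite mulr_sumr.
  by apply: eq_bigr => m _; rewrite exprMn; ring.
under eq_fun do rewrite e.
rewrite /egf_sum mulr_suml; apply: cvg_bigsum => k.
rewrite -[X in _ --> X]mulrA [X in _ --> X]mulrCA; apply: cvgM; first exact: cvg_cst.
exact: cvg_moment.
Qed.

Lemma cvg_mixed_exp x : mixed_exp x M @[M --> \oo] --> expR (expR (2 * x) / 2).
Proof.
have := @cvg_exp_sum (expR (2 * x) / 2).
apply: cvg_trans; apply: near_eq_cvg; apply: nearW => M.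
rewrite exp_sumE /mixed_exp; apply: eq_bigr => m _.
have -> : m.*2%:R * x = m%:R * (2 * x) by rewrite -muln2 natrM mulrA.
by rewrite exprMn [RHS]mulrC (expRM_natl m) mulrA.
Qed.

(** This reduces the convergence at x to the convergence at the absolute value of x. *)
Lemma egf_sum_tail n x :
  `|expR (expR (2 * x) / 2) - egf_sum n x * expR 2^-1| <=
  expR (expR (2 * `|x|) / 2) - egf_sum n `|x| * expR 2^-1.
Proof.
have h z : mixed_exp z M - mixed_sum z n M @[M --> \oo] -->
    expR (expR (2 * z) / 2) - egf_sum n z * expR 2^-1.
  by apply: cvgB; [apply: cvg_mixed_exp | apply: cvg_mixed_sum].
apply: (ler_cvgn (cvg_norm (h x)) (h _)) => M.
rewrite /mixed_exp /mixed_sum -!sumrB.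
apply: le_trans (ler_norm_sum _ _ _) _; apply: ler_sum => m _.
rewrite -!mulrBr normrM (ger0_norm (poisson_weight_ge0 m)).
apply: ler_wpM2l; first exact: poisson_weight_ge0.
by apply: le_trans (exp_tail_le _ _) _; rewrite normrM normr_nat.
Qed.

(** All terms of the double series of (2 m x)^k / k! with these weights are
    nonnegative, so the two orders of summation give the same value. *)
Lemma cvg_egf_sum_ge0 x : 0 <= x ->
  egf_sum n x * expR 2^-1 @[n --> \oo] --> expR (expR (2 * x) / 2).
Proof.
move=> x0; set g := expR (expR (2 * x) / 2).
have mx m : 0 <= m.*2%:R * x by rewrite mulr_ge0.
have ub n : egf_sum n x * expR 2^-1 <= g.
  apply: (ler_cvgn (@cvg_mixed_sum x n) (@cvg_mixed_exp x)) => M.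
  apply: ler_sum => m _; apply: ler_wpM2l; first exact: poisson_weight_ge0.
  exact: exp_sum_le.
have mono : {homo (fun n => egf_sum n x * expR 2^-1) : n m / (n <= m)%N >-> n <= m}.
  move=> n m nm; apply: ler_wpM2r; first exact: expR_ge0.
  rewrite /egf_sum (@big_cat_nat _ _ _ n 0 m) //= lerDl sumr_ge0 // => k _.
  by rewrite !mulr_ge0 ?exprn_ge0 ?invr_ge0.
have cv : cvgn (fun n => egf_sum n x * expR 2^-1).
  by apply: nondecreasing_is_cvgn => //; exists g => _ [n _ <-].
suff <- : limn (fun n => egf_sum n x * expR 2^-1) = g by [].
apply/eqP; rewrite eq_le; apply/andP; split.
  by apply: limr_le => //; apply: nearW.
apply: (ler_cvgn (@cvg_mixed_exp x) (cvg_cst _)) => M.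
have hM : mixed_sum x n M @[n --> \oo] --> mixed_exp x M.
  apply: cvg_bigsum => m; apply: cvgM; first exact: cvg_cst.
  exact: cvg_exp_sum.
apply: (ler_cvgn hM cv) => n.
apply: (ler_cvg_to (cvg_cst (mixed_sum x n M)) (@cvg_mixed_sum x n)).
near=> K; rewrite /mixed_sum (@big_cat_nat _ _ _ M 0 K) //=; last by near: K; exact: nbhs_infty_ge.
rewrite lerDl sumr_ge0 // => m _; rewrite mulr_ge0 ?poisson_weight_ge0 //.
by rewrite exp_sumE sumr_ge0 // => k _; rewrite mulr_ge0 ?exprn_ge0 ?invr_ge0.
Unshelve. all: by end_near.
Qed.

Lemma cvg_egf_sum x : egf_sum n x @[n --> \oo] --> expR ((expR (2 * x) - 1) / 2).
Proof.
set g := expR (expR (2 * x) / 2).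
have abs0 : `|g - egf_sum n x * expR 2^-1| @[n --> \oo] --> (0 : R).
  apply: (@squeeze_cvgr _ _ _ _ (fun=> 0) (fun n => expR (expR (2 * `|x|) / 2) - egf_sum n `|x| * expR 2^-1)).
  - by apply: nearW => n; rewrite normr_ge0 egf_sum_tail.
  - exact: cvg_cst.
  - rewrite -[X in _ --> X](subrr (expR (expR (2 * `|x|) / 2))).
    by apply: cvgB; [apply: cvg_cst | apply: cvg_egf_sum_ge0].
have -> : expR ((expR (2 * x) - 1) / 2) = g / expR 2^-1.
  by rewrite /g -expRB; congr expR; ring.
have cg : egf_sum n x * expR 2^-1 @[n --> \oo] --> g.
  apply/cvgrPdist_lt => e e0; move/cvgrPdist_lt: abs0 => /(_ e e0).
  by apply: filterS => n; rewrite sub0r normrN normr_id.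
have nz : expR 2^-1 != 0 :> R by rewrite gt_eqF ?expR_gt0.
under eq_fun => n do rewrite -[egf_sum n x](mulfK nz).
by apply: cvgM cg (cvg_cst _).
Qed.
End Dobinski.

(** * The enumeration *)

(** Any n that bounds the sequence, such as the sum of its entries, shows that a
    limiting tableau is a walk; conversely the sequence realizing a walk does so for
    every large m. *)
Lemma limiting_tableauxE k : limiting_tableaux k = [set` walks k [::]]%classic.
Proof.
apply/seteqP; split=> [P [s [s0 lim]]|w /= wk].
  have sn : in_range (sumn s) s.
    apply/allP=> x xs; rewrite (allP s0) //=.
    by have /perm_sumn -> := perm_to_rem xs; apply: leq_addr.
  rewrite /= -(lim (sumn s) (sumn s + 2 * k).+1) //.
  apply: star_vacillating_walk sn _; first by rewrite size_tuple.
  by rewrite ltnS leq_add2l mul2n -addnn leq_addr.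
have [s [/eqP sk s0 run]] := walk_limiting wk.
exists (Tuple sk); split=> // n m sn nm; apply: run sn _.
by apply: leq_ltn_trans nm; rewrite leq_add2l mul2n -addnn leq_addr.
Qed.

Lemma num_limiting_tableauxE k : num_limiting_tableaux k = size (walks k [::]).
Proof.
case: k => [//|k]; rewrite /num_limiting_tableaux limiting_tableauxE.
have := walks_uniq k.+1 (erefl : is_part [::]).
move: (walks _ _) => s us; rewrite -[X in _ = size X](undup_id us) -card_fseq.
congr (#|` _|)%fset; apply/fsetP=> w; rewrite in_fset_set; last exact: finite_seq.
by rewrite !inE; apply/asboolP/idP.
Qed.

Import GRing.Theory Num.Theory numFieldNormedType.Exports.
Local Open Scope classical_set_scope.
Local Open Scope ring_scope.

Theorem corollary9 :
  (forall k : nat, (0 < k)%N ->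
     num_limiting_tableaux k =
     (\sum_(1 <= j < k.+1) stirling2 k j * num_involutions j)%N)
  /\ (forall n : nat,
        egf num_limiting_tableaux n =
        fps_exp (fun i => (fps_exp fps_2X i - fps_one i) / 2) n)
  /\ (forall (R : realType) (x : R),
        [series (num_limiting_tableaux k)%:R * (x ^+ k / (k`!)%:R)]_k @ \oo
          --> expR ((expR (2 * x) - 1) / 2)).
Proof.
have a0 : num_limiting_tableaux 0 = 1%N by [].
have arec n : (num_limiting_tableaux n.+1 =
    \sum_(i < n.+1) 'C(n, i) * 2 ^ i * num_limiting_tableaux (n - i))%N.
  rewrite num_limiting_tableauxE size_walks_rec.
  by apply: eq_bigr => i _; rewrite num_limiting_tableauxE.
split; last split.
- move=> k k0; rewrite num_limiting_tableauxE size_walks_stirling big_ord_recl.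
  rewrite (_ : stirling_rec k 0 = 0%N) ?mul0n ?add0n; last by case: k k0.
  rewrite big_add1 big_mkord; apply: eq_bigr => j _.
  by rewrite stirling2E num_involutionsE.
- by move=> n; apply: egf_of_rec.
- by move=> R x; apply: cvg_egf_sum.
Qed.
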